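(* Let $G$ be a finitely generated group and let $S$ be a tree with an action of $G$. Assume that $S$ is locally finite or slender. Then there exists a finite set $\mathcal{I}$ of segments $I_i\subset S$ of length at most $4$ with the following property: if $h\in G$ is hyperbolic in $S$ and its axis contains a translate of each $I_i$, then $h$ is hyperbolic in every non-trivial slender tree $T$ (with an action of $G$) such that $S$ is elliptic with respect to $T$.
   Context: All trees are simplicial trees with an action of $G$ that is minimal (no proper invariant subtree), without inversion, and without redundant vertices (if $v$ is a vertex of valence 2, there is $g\in G$ having $v$ as its unique fixed point). A tree is trivial if it is a point. Trees carry the simplicial metric (every edge has length 1). A segment is the geodesic joining two vertices; the translates of a segment $I$ are the segments $gI$, $g\in G$. A group is slender if it and all its subgroups are finitely generated; a tree with an action of $G$ is slender if its edge stabilizers are slender. An element (or subgroup) of $G$ is elliptic in a tree if it fixes a point; a non-elliptic element is hyperbolic and has an axis, a line on which it acts as a translation. If $S,T$ are two trees with actions of $G$, then $S$ is elliptic with respect to $T$ if every edge stabilizer of $S$ is elliptic in $T$. *)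

(* Defs.v *)
From mathcomp Require Import all_boot all_order all_algebra.
From mathcomp Require Import monoid.
From mathcomp Require Import mathcomp_extra boolp classical_sets functions cardinality.

Set Implicit Arguments.
Unset Strict Implicit.
Unset Printing Implicit Defensive.

Import GRing.Theory.

Local Open Scope group_scope.
Local Open Scope classical_set_scope.

Section Groups.
Variable G : groupType.
Implicit Types H K : set G.

Definition is_subgroup H : Prop :=
  [/\ H 1, forall g h, H g -> H h -> H (g * h) & forall g, H g -> H g^-1].

Definition generated_by (s : seq G) : set G :=
  smallest is_subgroup [set` s].

Definition finitely_generated H : Prop := exists s : seq G, H = generated_by s.

Definition slender H : Prop :=
  finitely_generated H /\
  forall K, is_subgroup K -> K `<=` H -> finitely_generated K.

End Groups.

(* A simplicial tree is encoded by its vertices and their adjacency relation. *)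
Section Graphs.
Variables (V : choiceType) (adj : rel V).

Definition connected_set (A : set V) : Prop :=
  forall x y, A x -> A y ->
  exists p : seq V, [/\ path adj x p, last x p = y & forall z, z \in p -> A z].

(* The cycles of size at most 2 are back-and-forth walks along an edge. *)
Definition acyclic : Prop :=
  forall c : seq V, (2 < size c)%N -> ~~ (cycle adj c && uniq c).

Definition is_tree : Prop :=
  [/\ symmetric adj, irreflexive adj, [set: V] !=set0,
      connected_set [set: V] & acyclic].

(* The vertex set of a subtree; an induced subgraph loses no generality, as a
   connected subgraph of a tree contains every edge between its vertices. *)
Definition is_subtree (A : set V) : Prop := A !=set0 /\ connected_set A.

Definition is_geodesic (x : V) (p : seq V) : Prop :=
  path adj x p /\
  forall q, path adj x q -> last x q = last x p -> (size p <= size q)%N.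

Definition is_dist (x y : V) (n : nat) : Prop :=
  exists p, [/\ is_geodesic x p, last x p = y & size p = n].

Definition neighbours (x : V) : set V := [set y | adj x y].

Definition valence2 (x : V) : Prop :=
  exists y z, y <> z /\ neighbours x = [set y; z].

(* A line: an isometric embedding of the simplicial line. *)
Definition is_line (l : int -> V) : Prop :=
  forall i j : int, is_dist (l i) (l j) `|(i - j)%R|%N.

End Graphs.

(* A tree with an action of G by automorphisms. Actions are without inversion,
   so an element (or subgroup) that fixes a point inside an edge fixes both of
   its endpoints: it is enough to consider fixed vertices throughout. *)
Record Gtree (G : groupType) := MkGtree {
  vertex :> choiceType;
  adj : rel vertex;
  act : G -> vertex -> vertex;
  adj_tree : is_tree adj;
  act1 : forall x, act 1 x = x;
  actM : forall g h x, act (g * h) x = act g (act h x);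
  act_adj : forall g x y, adj (act g x) (act g y) = adj x y;
  act_minimal : forall A : set vertex, is_subtree adj A ->
    (forall g x, A x -> A (act g x)) -> A = [set: vertex];
  act_no_inversion : forall g x y, adj x y -> ~ (act g x = y /\ act g y = x);
  act_no_redundant : forall x, valence2 adj x ->
    exists g, forall y, act g y = y <-> y = x
}.

Section Trees.
Variables (G : groupType) (T : Gtree G).

Definition trivial_tree : Prop := exists x : T, forall y : T, y = x.

Definition locally_finite : Prop :=
  forall x : T, finite_set (neighbours (@adj G T) x).

(* As there is no inversion, stabilizing an edge means fixing its endpoints. *)
Definition edge_stab (x y : T) : set G :=
  [set g | act g x = x /\ act g y = y].

Definition slender_tree : Prop :=
  forall x y : T, adj x y -> slender (edge_stab x y).

Definition elliptic_subgroup (H : set G) : Prop :=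
  exists x : T, forall h, H h -> act h x = x.

Definition elliptic (h : G) : Prop := exists x : T, act h x = x.

Definition hyperbolic (h : G) : Prop := ~ elliptic h.

Definition is_axis (h : G) (l : int -> T) : Prop :=
  is_line (@adj G T) l /\
  exists n : int, n <> 0%R /\ forall i, act h (l i) = l (i + n)%R.

(* A segment is given by the sequence of its vertices, endpoints included. *)
Definition is_segment (I : seq T) : Prop :=
  if I is x :: p then is_geodesic (@adj G T) x p else False.

Definition seg_length (I : seq T) : nat := (size I).-1.

Definition translate (g : G) (I : seq T) : seq T := [seq act g x | x <- I].

Definition line_contains (l : int -> T) (I : seq T) : Prop :=
  [set` I] `<=` range l.

End Trees.

Definition elliptic_wrt (G : groupType) (S T : Gtree G) : Prop :=
  forall x y : S, adj x y -> elliptic_subgroup T (edge_stab x y).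

(* Main.v *)
Require Import Defs.
From mathcomp Require Import all_boot all_order all_algebra.
From mathcomp Require Import monoid.
From mathcomp Require Import mathcomp_extra boolp classical_sets functions cardinality.
From mathcomp Require Import zify.

Set Implicit Arguments.
Unset Strict Implicit.
Unset Printing Implicit Defensive.

Import GRing.Theory.

Local Open Scope classical_set_scope.

(** Let h translate along an axis in S, and suppose that h fixes a vertex t0
   of T. Fix an edge [a, b] of T; its stabilizer K is slender. By minimality
   of T the points g t0 lie on both sides of [a, b], and the aim is to show
   that they cannot, once the axis of h is rich enough. The argument is in the
   spirit of the Whitehead cut vertex lemma for free groups.

   Send the edges of S equivariantly to T, by choosing points fixed by their
   stabilizers ([edge_map]). The edge [a, b] then divides the edges of S into
   two classes. The vertices of S at which both classes occur form a set that
   is finite modulo K ([separated_bounded]). Unless a power of the conjugate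
   of h by g belongs to K, both ends of the axis g l are made of edges on the
   side of g t0 ([axis_ends]), so the axis remembers the side of g t0.

   A slender group acting on a tree fixes a vertex or preserves a line
   ([slender_core]). Apply this to K acting on S. In a half-tree disjoint from
   that core and far from it, no vertex is separated, so all axes entering it
   have their fixed points on the same side. This property propagates towards
   the core ([pure_off_core]): if the turns in the family connect the
   directions at a vertex w, even after removal of the direction that leads
   to the core, then the sides agree in all the other directions at w. If
   the core is a vertex, one more such step gives a contradiction
   ([core_vertex]). If it is a line, one uses in the same way that the
   directions at a vertex of the line stay connected when two of them are
   removed, and that segments of length 3 or 4 in the family leave the line at
   two successive branch vertices. Such vertices are at distance at most 2,
   since two adjacent vertices of valence 2 force S to be a line. So all axes
   other than the core line give the same side, and then the core line is
   preserved by G, hence equal to S ([core_line]). The case where S is a line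
   is settled directly ([line_case]).

   It remains to find finitely many turns that connect the directions at every
   vertex, after removal of any two of them. If S is locally finite all turns
   can be taken. Otherwise finite generation of G provides finitely many turns
   that connect the directions ([turns_connected]), and slenderness of the
   edge stabilizers allows finitely many more to make these connections robust
   ([robust_slender]). *)

(** * Connectedness for a relation *)

Section Closure.
Variable X : Type.
Implicit Types R : X -> X -> Prop.

(** The impredicative form of the reflexive transitive closure: connectedness
    is always used to transport a property along the steps of R. *)
Definition conn R (x y : X) : Prop :=
  forall P : X -> Prop, (forall a b, P a -> R a b -> P b) -> P x -> P y.

Lemma conn_refl R x : conn R x x. Proof. by []. Qed.

Lemma conn_step R x y : R x y -> conn R x y.
Proof. by move=> Rxy P PR Px; apply: PR Px Rxy. Qed.

Lemma conn_trans R x y z : conn R x y -> conn R y z -> conn R x z.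
Proof. by move=> xy yz P PR /(xy P PR) /(yz P PR). Qed.

Lemma conn_sym R x y : (forall a b, R a b -> R b a) -> conn R x y -> conn R y x.
Proof.
move=> Rsym xy; apply: (xy (fun z => conn R z x)); last exact: conn_refl.
by move=> a b ax Rab; exact: conn_trans (conn_step (Rsym _ _ Rab)) ax.
Qed.

Lemma conn_mono R R' x y :
  (forall a b, R a b -> R' a b) -> conn R x y -> conn R' x y.
Proof. by move=> RR' xy P PR; apply: xy => a b Pa /RR'; apply: PR. Qed.

End Closure.

Lemma conn_map (X Y : Type) (R : X -> X -> Prop) (R' : Y -> Y -> Prop) (f : X -> Y) x y :
  (forall a b, R a b -> R' (f a) (f b)) -> conn R x y -> conn R' (f x) (f y).
Proof.
move=> RR' xy P PR Px; apply: (xy (P \o f)) => //= a b Pa /RR'; exact: PR.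
Qed.


(** * Distances and half-trees *)

Section Dist.
Variables (V : choiceType) (adj : rel V).

Definition gdist (x y : V) : nat := xget 0 [set n | is_dist adj x y n].

(** The half-tree beyond the edge [x, y]. Testing membership by comparing
    distances turns most arguments about half-trees into arithmetic. *)
Definition half (x y z : V) : bool := gdist z y < gdist z x.

Hypothesis treeP : is_tree adj.

Let adj_sym : symmetric adj. Proof. by case: treeP. Qed.
Let adj_irr : irreflexive adj. Proof. by case: treeP. Qed.

Lemma gdistP x y : is_dist adj x y (gdist x y).
Proof.
rewrite /gdist; case: xgetP => [n -> //|none].
have [_ _ _ conT _] := treeP.
have [p [xp lp _]] := conT x y I I.
pose Q n := `[< exists q, [/\ path adj x q, last x q = y & size q = n] >].
have exQ : exists n, Q n by exists (size p); apply/asboolP; exists p.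
case: (ex_minnP exQ) => n /asboolP[q [xq lq sq]] minn.
case: (none n); exists q; split=> //; split=> // r xr lr.
by rewrite sq; apply: minn; apply/asboolP; exists r; split=> //; rewrite lr.
Qed.

Lemma gdist_le x p : path adj x p -> gdist x (last x p) <= size p.
Proof.
move=> xp; have [q [[_ qmin] lq <-]] := gdistP x (last x p).
by apply: qmin => //; rewrite lq.
Qed.

Lemma gdist_path x y :
  exists p, [/\ path adj x p, last x p = y & size p = gdist x y].
Proof. by have [p [[xp _] lp sp]] := gdistP x y; exists p. Qed.

Lemma is_distE x y n : is_dist adj x y n <-> gdist x y = n.
Proof.
split=> [[p [[xp pmin] lp <-]]|<-]; last exact: gdistP.
apply/eqP; rewrite eqn_leq -lp gdist_le //=.
by have [q [xq lq <-]] := gdist_path x (last x p); apply: pmin.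
Qed.

Lemma is_geodesicE x p :
  is_geodesic adj x p <-> path adj x p /\ gdist x (last x p) = size p.
Proof.
split=> [[xp pmin]|[xp dp]].
  by split=> //; apply/is_distE; exists p.
split=> // q xq lq; rewrite -dp -lq; exact: gdist_le.
Qed.

Lemma gdistxx x : gdist x x = 0.
Proof. by have := @gdist_le x [::] isT; rewrite leqn0 => /eqP. Qed.

Lemma gdist_eq0 x y : gdist x y = 0 -> x = y.
Proof. by have [p [_ <- <-]] := gdist_path x y; case: p. Qed.

Lemma gdist_tri y x z : gdist x z <= gdist x y + gdist y z.
Proof.
have [p [xp lp <-]] := gdist_path x y; have [q [yq lq <-]] := gdist_path y z.
rewrite -size_cat -lq -lp -last_cat; apply: gdist_le.
by rewrite cat_path xp lp.
Qed.

Lemma gdist_sym x y : gdist x y = gdist y x.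
Proof.
suff le u v : gdist v u <= gdist u v by apply/eqP; rewrite eqn_leq !le.
have [p [up <- <-]] := gdist_path u v.
have := @gdist_le (last u p) (rev (belast u p)).
rewrite rev_path (eq_path (e' := adj)); last by move=> a b; rewrite adj_sym.
move=> /(_ up); rewrite size_rev size_belast.
by case: (p) => //= a q; rewrite rev_cons last_rcons.
Qed.

Lemma gdist_adj x y : adj x y -> gdist x y = 1.
Proof.
move=> xy; have := @gdist_le x [:: y]; rewrite /= xy => /(_ isT).
case E: (gdist x y) => [|[|//]] // _.
by move: xy; rewrite (gdist_eq0 E) adj_irr.
Qed.

Lemma gdist1 x y : gdist x y = 1 -> adj x y.
Proof.
by have [p [xp <- <-]] := gdist_path x y; case: p xp => // a [|//] /andP[].
Qed.

(** Such a path, once its loops are removed, would be closed up by the edge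
    [x, y] to a cycle. *)
Lemma no_detour x y p : adj x y ->
  path [rel a b | [&& adj a b, (a, b) != (x, y) & (a, b) != (y, x)]] x p ->
  last x p <> y.
Proof.
move=> xy /shortenP[q xq uq _] lq.
have xq' : path adj x q by apply: sub_path xq => a b /= /and3P[].
have [_ _ _ _ /(_ (x :: q))] := treeP.
case: q xq uq lq xq' => [_ _ /= E _|a [|b q] xq uq lq xq'].
- by move: xy; rewrite -E adj_irr.
- by move: lq xq => /= ->; rewrite eqxx andbF.
- move=> /(_ isT)/negP; apply; rewrite uq andbT.
  rewrite [cycle _ _]/= -[_ && _]/(path adj x (rcons (a :: b :: q) x)).
  by rewrite rcons_path xq' lq adj_sym.
Qed.

Lemma gdist_adj_le x y z : adj x y -> gdist z y <= (gdist z x).+1.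
Proof. by move=> /gdist_adj xy; have := gdist_tri x z y; rewrite xy addn1. Qed.

(** The strict monotonicity of the distance to y along the path bounds the
    vertices and the edges that the path may visit; this is how geodesics are
    kept away from a given edge in the next lemmas. *)
Lemma monotone_geodesic x y : exists p, [/\ path adj x p, last x p = y &
  path [rel a b | (adj a b) && (gdist a y == (gdist b y).+1)] x p].
Proof.
move En: (gdist x y) => n; elim: n x En => [|n IH] x En.
  by exists [::]; rewrite (gdist_eq0 En).
have [[|a p] [xp lp sp]] := gdist_path x y; first by move: sp; rewrite En.
move: xp lp sp => /= /andP[xa ap] lp sp.
have Ea : gdist a y = n.
  have := gdist_le ap; rewrite lp.
  by have := gdist_tri a x y; rewrite (gdist_adj xa); move: sp => /=; lia.
have [q [aq lq mq]] := IH a Ea.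
by exists (a :: q); rewrite /= xa aq lq mq Ea En eqxx.
Qed.

Lemma gdist_step z x n : gdist z x = n.+1 -> exists2 y, adj x y & gdist z y = n.
Proof.
have [[|a p] [xp lp mp]] := monotone_geodesic x z.
  by rewrite -lp /= gdistxx.
move: mp => /= /andP[/andP[xa /eqP E] _].
by rewrite gdist_sym E => -[<-]; exists a => //; rewrite gdist_sym.
Qed.

(** If x and y were equally far from z, geodesics from x to z and from z to y
    would make up a walk along which the distance to z always changes, hence a
    detour around [x, y]. *)
Lemma gdist_adj_neq x y z : adj x y -> gdist z x <> gdist z y.
Proof.
move=> xy E.
have [p [xp lp mp]] := monotone_geodesic x z.
have [q [yq lq mq]] := monotone_geodesic y z.
have zq : path adj z (rev (belast y q)).
  by rewrite -lq rev_path (eq_path (e' := adj)) // => a b; rewrite adj_sym.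
have lzq : last z (rev (belast y q)) = y.
  by rewrite -lq; case: (q) => //= a r; rewrite rev_cons last_rcons.
apply: (@no_detour x y (p ++ rev (belast y q)) xy); last by rewrite last_cat lp.
rewrite cat_path; apply/andP; split.
  apply: sub_path mp => a b /= /andP[-> /eqP ab] /=.
  by apply/andP; split; apply/eqP => -[? ?]; subst a b; 
     move: ab E; rewrite !(gdist_sym _ z); lia.
rewrite lp -lq rev_path; apply: sub_path mq => a b /= /andP[ab /eqP dab].
rewrite adj_sym ab /=.
by apply/andP; split; apply/eqP => -[? ?]; subst a b; 
     move: dab E; rewrite !(gdist_sym _ z); lia.
Qed.

Lemma gdist_adjP x y z : adj x y ->
  gdist z y = (gdist z x).+1 \/ gdist z x = (gdist z y).+1.
Proof.
move=> xy; have := gdist_adj_le z xy; rewrite adj_sym in xy.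
by have := gdist_adj_le z xy; have := @gdist_adj_neq _ _ z xy; lia.
Qed.

(** Geodesics from two neighbours of x towards z stay away from x, so they
    join these neighbours by a walk that is a detour around an edge at x. *)
Lemma closer_uniq x y y' z : adj x y -> adj x y' ->
  gdist z y < gdist z x -> gdist z y' < gdist z x -> y = y'.
Proof.
move=> xy xy' dy dy'; apply: contrapT => /eqP yy'.
have [p [yp lp mp]] := monotone_geodesic y z.
have [q [yq lq mq]] := monotone_geodesic y' z.
have out r a : path [rel a b | adj a b && (gdist a z == (gdist b z).+1)] a r ->
    gdist z a < gdist z x -> x \notin (a :: r).
  elim: r a => [|b r IH] a /=.
    by move=> _ ax; rewrite inE; apply/eqP => xa; move: ax; rewrite xa ltnn.
  move=> /andP[/andP[_ /eqP ab] br] ax; rewrite inE negb_or IH // ?andbT.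
    by apply/eqP => xa; move: ax; rewrite xa ltnn.
  by move: ax ab; rewrite !(gdist_sym z); lia.
have zq : path adj z (rev (belast y' q)).
  by rewrite -lq rev_path (eq_path (e' := adj)) // => a b; rewrite adj_sym.
have lzq : last z (rev (belast y' q)) = y'.
  by rewrite -lq; case: (q) => //= a r; rewrite rev_cons last_rcons.
have yx : adj y x by rewrite adj_sym.
apply: (@no_detour y x (p ++ rcons (rev (belast y' q)) x) yx); last first.
  by rewrite last_cat last_rcons.
have xp := out _ _ mp dy; have xq := out _ _ mq dy'.
rewrite cat_path rcons_path lp lzq /= (adj_sym y' x) xy' /=.
apply/and4P; split.
- rewrite -[path _ y p]/(sorted _ (y :: p)).
  have : {in y :: p &, forall a b, adj a b ->
     [&& adj a b, (a, b) != (y, x) & (a, b) != (x, y)]}.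
    move=> a b ayp byp -> /=; apply/andP; split; apply/eqP => -[? ?]; subst.
      by move: xp; rewrite byp.
    by move: xp; rewrite ayp.
  move=> sub; apply: (sub_in_sorted (P := [in y :: p])); last 2 first.
  - exact/allP.
  - exact: yp.
  - by move=> a b /= ayp byp; apply: sub.
- rewrite -[path _ z _]/(sorted _ (z :: _)).
  have zE : z :: rev (belast y' q) = rev (y' :: q).
    by rewrite [y' :: q]lastI rev_rcons lq.
  apply: (sub_in_sorted (P := [in y' :: q])); last 2 first.
  - by rewrite zE all_rev; apply/allP.
  - exact: zq.
  move=> a b /= ayp byp -> /=; apply/andP; split; apply/eqP => -[? ?]; subst.
    by move: xq; rewrite byp.
  by move: xq; rewrite ayp.
- by apply/eqP => -[E]; move: yy'; rewrite E eqxx.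
- by apply/eqP => -[E1 E2]; move: xy'; rewrite E1 adj_irr.
Qed.

End Dist.

Section HalfTrees.
Variables (V : choiceType) (adj : rel V).
Hypothesis treeP : is_tree adj.

Local Notation d := (gdist adj).
Local Notation H := (half adj).

Let adj_sym : symmetric adj. Proof. by case: treeP. Qed.

Lemma halfC x y z : adj x y -> H y x z = ~~ H x y z.
Proof. by move=> /(gdist_adjP treeP z); rewrite /half; lia. Qed.

Lemma half_in x y : adj x y -> H x y y.
Proof.
by move=> xy; rewrite /half gdistxx // gdist_sym // (gdist_adj treeP xy).
Qed.

Lemma half_out x y : ~~ H x y x.
Proof. by rewrite /half gdistxx. Qed.

(** If z were not y, the next vertex from y towards z would be a second
    neighbour of y closer to z', besides x. So [x, y] is the only edge that
    joins its two sides. *)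
Lemma half_cross x y z z' : adj x y -> adj z z' -> H x y z -> ~~ H x y z' ->
  z = y /\ z' = x.
Proof.
move=> xy zz'; rewrite /half -leqNgt => hz hz'.
have ez := gdist_adjP treeP z xy; have ez' := gdist_adjP treeP z' xy.
have sx := gdist_adjP treeP x zz'; have sy := gdist_adjP treeP y zz'.
rewrite !(gdist_sym treeP _ z) !(gdist_sym treeP _ z') in sx sy.
suff z0 : d z y = 0 by split; apply: (gdist_eq0 treeP) => //; lia.
case E: (d z y) => [//|m].
rewrite (gdist_sym treeP) in E.
have [y1 zy1 E1] : exists2 y1, adj y y1 & d z y1 = m.
  by apply: gdist_step => //; rewrite gdist_sym.
have := gdist_adj_le treeP y1 zz'.
rewrite !(gdist_sym treeP y1) => zy1'.
have y1x : y1 = x.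
  apply: (@closer_uniq _ _ treeP y _ _ z') => //; first by rewrite adj_sym.
    by rewrite (gdist_sym treeP y) in E; lia.
  by lia.
by move: E E1; rewrite y1x (gdist_sym treeP y); lia.
Qed.

Lemma half_sub v w u z : adj v w -> adj w u -> u <> v -> H w u z -> H v w z.
Proof.
move=> vw wu uv hu; rewrite -[H v w z]negbK -halfC //; apply/negP => hv.
by apply: uv; apply: (closer_uniq treeP wu _ hu hv); rewrite adj_sym.
Qed.

Lemma half_disj v u u' z : adj v u -> adj v u' -> H v u z -> H v u' z -> u = u'.
Proof. by move=> vu vu' hu hu'; exact: (closer_uniq treeP vu vu' hu hu'). Qed.

Lemma half_exists v z : z <> v -> exists2 u, adj v u & H v u z.
Proof.
move=> zv; case E: (d z v) => [|n].
  by case: zv; exact: (gdist_eq0 treeP).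
by have [u vu Eu] := gdist_step treeP E; exists u; rewrite // /half Eu E.
Qed.

(** By induction along a geodesic from v to y, which never enters the
    half-tree: a step that decreases the distance to z would have to go back
    to the previous vertex, or to u at the start. *)
Lemma half_dist v u z y : adj v u -> H v u z -> ~~ H v u y ->
  d z y = d z v + d v y.
Proof.
move=> vu hz; move En: (d v y) => n.
elim/ltn_ind: n y En => n IH y En hy.
case: n => [|n] in IH En *; first by rewrite -(gdist_eq0 treeP En) addn0.
have Ey : d v y = n.+1 by [].
have [y' yy' Ey'] := gdist_step treeP Ey.
have y'y : adj y' y by rewrite adj_sym.
have hy' : ~~ H v u y'.
  apply/negP => hy'; have [_ yv] := half_cross vu y'y hy' hy.
  by move: Ey; rewrite yv gdistxx.
have Ezy' := IH n (ltnSn n) y' Ey' hy'.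
have [->|Ezy] := gdist_adjP treeP z y'y; first by lia.
case: n => [|n] in IH En Ey Ey' Ezy' Ezy *.
  have y'v : y' = v by rewrite (gdist_eq0 treeP Ey').
  case/negP: hy; suff -> : y = u by exact: half_in.
  rewrite y'v in y'y Ezy *; apply: (closer_uniq treeP y'y vu _ hz); lia.
have [y'' y'y'' Ey''] := gdist_step treeP Ey'.
have hy'' : ~~ H v u y''.
  have y''y' : adj y'' y' by rewrite adj_sym.
  apply/negP => h; have [_ yv] := half_cross vu y''y' h hy'.
  by move: Ey'; rewrite yv gdistxx.
have Ezy'' := IH n (ltnW (ltnSn n.+1)) y'' Ey'' hy''.
suff yy'' : y = y'' by move: Ey Ey''; rewrite yy''; lia.
apply: (closer_uniq treeP y'y y'y'' (z := z)); lia.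
Qed.

(** The neighbour of b closer to z is unique, and it is a. *)
Lemma no_backtrack z a b c : adj a b -> adj b c -> a <> c ->
  d z b = (d z a).+1 -> d z c = (d z b).+1.
Proof.
move=> ab bc ac E; have [//|E'] := gdist_adjP treeP z bc.
case: ac; apply: (closer_uniq treeP (_ : adj b a) bc (z := z)); try lia.
by rewrite adj_sym.
Qed.

(** A criterion for connectedness adapted to half-trees: it is enough to
    produce the first step of a path. *)
Lemma step_subtree (A : set V) : A !=set0 ->
  (forall x y x', A x -> A y -> adj x x' -> H x x' y -> A x') ->
  is_subtree adj A.
Proof.
move=> A0 Astep; split=> // x y; move En: (d y x) => n.
elim: n x En => [|n IH] x En Ax Ay.
  by exists [::]; split=> //=; rewrite (gdist_eq0 treeP En).
have [x' xx' Ex'] := gdist_step treeP En.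
have Ax' : A x' by apply: (Astep x y) => //; rewrite /half Ex' En.
have [p [x'p lp Ap]] := IH x' Ex' Ax' Ay.
exists (x' :: p); split=> //=; first by rewrite xx'.
by move=> z; rewrite inE => /orP[/eqP->|/Ap].
Qed.

Lemma conn_tree (R : V -> V -> Prop) x y :
  (forall a b, adj a b -> R a b) -> conn R x y.
Proof.
move=> adjR; have [p [xp <- _]] := gdist_path treeP x y.
elim: p x xp => [|a p IH] x /=; first by move=> _; exact: conn_refl.
move=> /andP[xa ap]; exact: conn_trans (conn_step (adjR _ _ xa)) (IH _ ap).
Qed.

(** A step of a walk crosses no edge but itself, so the edges that separate s
    from t are among the finitely many edges of a geodesic. *)
Lemma separating_edges s t : exists L : seq (V * V), forall x y,
  adj x y -> H x y s != H x y t -> (x, y) \in L.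
Proof.
have [p [sp <- _]] := gdist_path treeP s t.
elim: p s sp => [|a p IH] s /=; first by exists [::] => x y _; rewrite eqxx.
move=> /andP[sa /IH[L LP]]; exists [:: (s, a), (a, s) & L] => x y xy sep.
have [Eas|nas] := eqVneq (H x y s) (H x y a).
  by rewrite !inE (LP x y) ?orbT // -Eas.
have as_ : adj a s by rewrite adj_sym.
case hs : (H x y s) nas => /=.
  move=> ha; have [] := half_cross xy sa hs; first by case: (H x y a) ha.
  by move=> -> ->; rewrite !inE eqxx orbT.
case ha : (H x y a) => //= _.
have [] := half_cross xy as_ ha; first by rewrite hs.
by move=> -> ->; rewrite !inE eqxx.
Qed.

End HalfTrees.

(** * Lines *)

Section Lines.
Variables (V : choiceType) (adj : rel V).
Hypothesis treeP : is_tree adj.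

Local Notation d := (gdist adj).
Local Notation H := (half adj).

Let adj_sym : symmetric adj. Proof. by case: treeP. Qed.

(** A discrete intermediate value theorem. *)
Lemma int_cross (P : int -> bool) i j : (i <= j)%R -> P i -> ~~ P j ->
  exists k, [/\ (i <= k)%R, (k < j)%R, P k & ~~ P (k + 1)%R].
Proof.
move=> ij; have [n ->] : exists n : nat, j = (i + n%:Z)%R.
  by exists `|j - i|%N; lia.
move=> Pi; elim: n => [|n IH]; first by rewrite addr0 Pi.
case Pn : (P (i + n%:Z)%R) => Pn1.
  exists (i + n%:Z)%R; split=> //; try lia.
  by rewrite -addrA -PoszD addn1.
by case: (IH (negbT Pn)) => k [? ? ? ?]; exists k; split=> //; lia.
Qed.

Section OneLine.
Variable l : int -> V.
Hypothesis lP : is_line adj l.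

Lemma line_dist i j : d (l i) (l j) = `|i - j|%N.
Proof. exact/(is_distE treeP). Qed.

Lemma line_adj i : adj (l i) (l (i + 1)%R).
Proof. by apply: (gdist1 treeP); rewrite line_dist; lia. Qed.

Lemma line_inj i j : l i = l j -> i = j.
Proof. by move=> E; have := line_dist i j; rewrite E gdistxx //; lia. Qed.

Lemma line_adjE i j : adj (l i) (l j) -> j = (i + 1)%R \/ j = (i - 1)%R.
Proof. by move=> /(gdist_adj treeP); rewrite line_dist; lia. Qed.

Lemma line_half i j : H (l i) (l (i + 1)%R) (l j) = (i < j)%R.
Proof. by rewrite /half !line_dist; lia. Qed.

Lemma line_rev : is_line adj (fun i => l (- i)%R).
Proof. by move=> i j; apply/(is_distE treeP); rewrite line_dist; lia. Qed.

Lemma line_shift c : is_line adj (fun i => l (i + c)%R).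
Proof. by move=> i j; apply/(is_distE treeP); rewrite line_dist; lia. Qed.

(** If both rays from l i left the half-tree, they would leave it through the
    same edge, and the line would visit a vertex twice. *)
Lemma line_ray v w i : adj v w -> H v w (l i) ->
  (forall j, (i <= j)%R -> H v w (l j)) \/ (forall j, (j <= i)%R -> H v w (l j)).
Proof.
move=> vw hi.
have [up|] := pselect (forall j, (i <= j)%R -> H v w (l j)); first by left.
move=> /existsNP[j /not_implyP[ij /negP nj]]; right=> j' j'i.
apply: contrapT => /negP nj'.
have [k [ik kj hk nk]] := int_cross (P := H v w \o l) ij hi nj.
have [lk _] := half_cross treeP vw (line_adj k) hk nk.
have [k' [k1 k2 /= hk' nk']] :=
  int_cross (P := fun m => ~~ H v w (l m)) j'i nj' (introT negPn hi).
have lk' : adj (l (k' + 1)%R) (l k') by rewrite adj_sym line_adj.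
have := half_cross treeP vw lk' (negbNE nk') hk'.
move=> [E _]; have := line_inj (etrans lk (esym E)).
move: nk; rewrite /= => nk.
have [_ Ev] := half_cross treeP vw (line_adj k) hk nk.
have [_ Ev'] := half_cross treeP vw lk' (negbNE nk') hk'.
have := line_inj (etrans Ev (esym Ev')); lia.
Qed.

(** Here l i is the projection of z to the line, and u is the first vertex
    after it on the way to z. *)
Lemma line_off z : ~ range l z -> exists i u, [/\ adj (l i) u, ~ range l u,
  H (l i) u z & forall j, ~~ H (l i) u (l j)].
Proof.
move=> nz; pose Q n := `[< exists i, d z (l i) = n >].
have exQ : exists n, Q n by exists (d z (l 0%R)); apply/asboolP; exists 0%R.
case: (ex_minnP exQ) => n /asboolP[i Ei] minn.
have mind j : n <= d z (l j) by apply: minn; apply/asboolP; exists j.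
have zi : z <> l i by move=> E; apply: nz; exists i.
have [u iu hu] := half_exists treeP zi.
have nu : ~ range l u.
  by move=> [j _ E]; have := mind j; rewrite E -Ei leqNgt => /negP; apply.
exists i, u; split=> // j; apply/negP => hj; apply: nu.
have [up|dn] := line_ray iu hj.
- have ji : (j <= i)%R \/ (i <= j)%R by lia.
  case: ji => ji; first by move: (up i ji); rewrite (negPf (half_out treeP _ _)).
  have [k [_ _ /= h1 h2]] := int_cross (P := fun m => ~~ H (l i) u (l m)) ji
    (half_out treeP _ _) (introT negPn hj).
  have ll : adj (l (k + 1)%R) (l k) by rewrite adj_sym line_adj.
  by have [<- _] := half_cross treeP iu ll (negbNE h2) h1; exists (k + 1)%R.
- have ji : (j <= i)%R \/ (i <= j)%R by lia.
  case: ji => ji; last by move: (dn i ji); rewrite (negPf (half_out treeP _ _)).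
  have [k [_ _ /= h1 h2]] := int_cross (P := H (l i) u \o l) ji hj (half_out treeP _ _).
  by have [<- _] := half_cross treeP iu (line_adj k) h1 h2; exists k.
Qed.

Lemma line_half_mono z i j : (i <= j)%R ->
  H (l j) (l (j + 1)%R) z -> H (l i) (l (i + 1)%R) z.
Proof.
move=> ij; have [n ->] : exists n : nat, j = (i + n%:Z)%R.
  by exists `|j - i|%N; lia.
elim: n => [|n IH]; first by rewrite addr0.
move=> h; apply: IH; move: h.
have -> : (i + n.+1%:Z = i + n%:Z + 1)%R by lia.
apply: half_sub => //; try exact: line_adj.
by move=> /line_inj; lia.
Qed.

(** The half-trees beyond the edges of a line form a decreasing family whose
    intersection and the intersection of whose complements are empty. *)
Lemma line_half_bound z : exists r s, [/\ (s <= r)%R,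
  ~~ H (l r) (l (r + 1)%R) z & H (l s) (l (s + 1)%R) z].
Proof.
exists (d z (l 0%R))%:Z%R, (- (d z (l 0%R))%:Z - 1)%R; split; first by lia.
  apply/negP; set r := (_%:Z)%R => h.
  have := half_dist treeP (line_adj r) h.
  move=> /(_ (l 0%R)); rewrite line_half => /(_ ltac:(lia)).
  have := half_in treeP (line_adj r).
  have zr : z <> l r by move=> E; move: h; rewrite E (negPf (half_out treeP _ _)).
  have : d z (l r) <> 0 by move/(gdist_eq0 treeP).
  by rewrite line_dist; lia.
set s := (- _ - 1)%R; rewrite -[H _ _ _]negbK -halfC ?line_adj //.
apply/negP => h.
have sl : adj (l (s + 1)%R) (l s) by rewrite adj_sym line_adj.
have := half_dist treeP sl h (y := l 0%R).
rewrite halfC ?line_adj // line_half => /(_ ltac:(lia)).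
have : d z (l (s + 1)%R) <> 0.
  by move/(gdist_eq0 treeP) => E; move: h; rewrite E (negPf (half_out treeP _ _)).
by rewrite line_dist; lia.
Qed.

End OneLine.

(** In a tree, a walk without backtracking is geodesic. *)
Lemma local_line (l : int -> V) : (forall i, adj (l i) (l (i + 1)%R)) ->
  (forall i, l i <> l (i + 2)%R) -> is_line adj l.
Proof.
move=> ladj lred.
have up i (n : nat) : d (l i) (l (i + n%:Z)%R) = n /\
    d (l i) (l (i + n.+1%:Z)%R) = n.+1.
  elim: n => [|n [E0 IH]]; first by rewrite addr0 gdistxx // (gdist_adj treeP).
  split=> //; rewrite -{2}IH.
  have -> : (i + n.+2%:Z = i + n.+1%:Z + 1)%R by lia.
  have E1 : (i + n.+1%:Z = i + n%:Z + 1)%R by lia.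
  apply: (no_backtrack treeP (a := l (i + n%:Z)%R)) => //.
  - rewrite E1; exact: ladj.
  - by rewrite E1 -addrA; exact: lred.
  - by rewrite IH E0.
move=> i j; apply/(is_distE treeP).
have [ij|ij] : (i <= j)%R \/ (j <= i)%R by lia.
  have [+ _] := up i `|j - i|%N.
  by rewrite (_ : (i + `|j - i|%N%:Z)%R = j); [move=> ->; lia | lia].
rewrite gdist_sym //; have [+ _] := up j `|i - j|%N.
by rewrite (_ : (j + `|i - j|%N%:Z)%R = i); [move=> -> | lia].
Qed.

End Lines.

(** * Subgroups and slender groups *)

Section Subgroups.
Variable G : groupType.
Implicit Types (H K : set G) (g h : G).

Lemma sub1 H : is_subgroup H -> H 1%g. Proof. by case. Qed.
Lemma subM H g h : is_subgroup H -> H g -> H h -> H (g * h)%g.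
Proof. by case=> _ HM _; apply: HM. Qed.
Lemma subV H g : is_subgroup H -> H g -> H g^-1%g.
Proof. by case=> _ _; apply. Qed.

Lemma subX H g n : is_subgroup H -> H g -> H (g ^+ n)%g.
Proof.
by move=> sH Hg; elim: n => [|n IH]; rewrite ?expgS; [exact: sub1|exact: subM].
Qed.

Lemma powers_subgroup g :
  is_subgroup [set (g ^+ m / g ^+ n)%g | m in setT & n in setT].
Proof.
split=> [|_ _ [m _ [n _ <-]] [p _ [q _ <-]]|_ [m _ [n _ <-]]].
- by exists 0 => //; exists 0 => //; rewrite expg0 mulgV.
- exists (m + p) => //; exists (q + n) => //.
  have C : (g ^- n * g ^+ p = g ^+ p * g ^- n)%g.
    exact/commute_sym/commuteV/commuteX2.
  by rewrite !expgnDr invgM !mulgA; congr (_ * _)%g; rewrite -!mulgA C.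
- by exists n => //; exists m => //; rewrite invgF.
Qed.

Lemma gen_subgroup s : is_subgroup (generated_by s : set G).
Proof.
split=> [K [sK _]|g h Hg Hh K [sK Ks]|g Hg K [sK Ks]].
- exact: sub1.
- by apply: subM => //; [exact: Hg|exact: Hh].
- by apply: subV => //; exact: Hg.
Qed.

Lemma gen_mem s g : g \in s -> generated_by s g.
Proof. by move=> gs K [_]; apply. Qed.

Lemma gen_min s H : is_subgroup H -> (forall g, g \in s -> H g) ->
  generated_by s `<=` H.
Proof. by move=> sH sub g; apply; split=> // h; exact: sub. Qed.

Lemma slender_sub H K : slender H -> is_subgroup K -> K `<=` H -> slender K.
Proof.
move=> [_ fgH] sK KH; split; first exact: fgH.
by move=> L sL LK; apply: fgH => // g /LK /KH.
Qed.

Lemma subgroupI H K : is_subgroup H -> is_subgroup K -> is_subgroup (H `&` K).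
Proof.
move=> sH sK; split=> [|g h [Hg Kg] [Hh Kh]|g [Hg Kg]].
- by split; exact: sub1.
- by split; exact: subM.
- by split; exact: subV.
Qed.

(** Slenderness is used as an ascending chain condition: the union of the
    chain is finitely generated, and its generators already lie in one term. *)
Lemma slender_chain H (P : nat -> set G) : slender H ->
  (forall n, is_subgroup (P n)) -> (forall n, P n `<=` H) ->
  (forall n, P n `<=` P n.+1) -> exists n, forall m, P m `<=` P n.
Proof.
move=> [_ fgH] sP PH Pinc.
have mono m n : m <= n -> P m `<=` P n.
  move=> /subnK <-; elim: (n - m) => [|k IH] //.
  by rewrite addSn; apply: subset_trans IH _; exact: Pinc.
pose U := [set g | exists n, P n g].
have sU : is_subgroup U.
  split=> [|g h [m Pg] [n Ph]|g [n Pg]].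
  - by exists 0; exact: sub1.
  - exists (maxn m n); apply: subM => //.
      by apply: mono Pg; exact: leq_maxl.
    by apply: mono Ph; exact: leq_maxr.
  - by exists n; exact: subV.
have [s Us] := fgH U sU (fun g '(ex_intro n Pg) => PH n g Pg).
have [n sn] : exists n, forall g, g \in s -> P n g.
  have : forall g, g \in s -> U g by move=> g gs; rewrite Us; exact: gen_mem.
  elim: s {Us} => [|a s IH] sU'; first by exists 0.
  have [n Pn] := IH (fun g gs => sU' g (mem_behead (s := a :: s) gs)).
  have [m Pa] := sU' a (mem_head _ _).
  exists (maxn m n) => g; rewrite inE => /orP[/eqP->|/Pn].
    by apply: mono Pa; exact: leq_maxl.
  by apply: mono; exact: leq_maxr.
exists n => m g Pg; have : U g by exists m.
by rewrite Us; apply: gen_min.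
Qed.

End Subgroups.

(** * Finite collections *)

(** Since Q is monotone, the witnesses for finitely many elements can be
    merged into a single list. All finiteness statements about orbits are
    assembled in this way. *)
Lemma collect (X : choiceType) (Y : eqType) (Q : X -> seq Y -> Prop) (s : seq X) :
  (forall a L L', {subset L <= L'} -> Q a L -> Q a L') ->
  (forall a, a \in s -> exists L, Q a L) ->
  exists L, forall a, a \in s -> Q a L.
Proof.
move=> mono; elim: s => [|a s IH] ex; first by exists [::].
have [L QL] := IH (fun b bs => ex b (mem_behead (s := a :: s) bs)).
have [L' QL'] := ex a (mem_head _ _).
exists (L ++ L') => b; rewrite inE => /orP[/eqP->|/QL].
  by apply: mono QL' => y; rewrite mem_cat => ->; rewrite orbT.
by apply: mono => y; rewrite mem_cat => ->.
Qed.

Lemma collect_bound (X : eqType) (Q : X -> nat -> Prop) (s : seq X) :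
  (forall a m n, m <= n -> Q a m -> Q a n) ->
  (forall a, a \in s -> exists n, Q a n) ->
  exists n, forall a, a \in s -> Q a n.
Proof.
move=> mono; elim: s => [|a s IH] ex; first by exists 0.
have [n Qn] := IH (fun b bs => ex b (mem_behead (s := a :: s) bs)).
have [m Qm] := ex a (mem_head _ _).
exists (maxn m n) => b; rewrite inE => /orP[/eqP->|/Qn].
  by apply: mono Qm; exact: leq_maxl.
by apply: mono; exact: leq_maxr.
Qed.

Lemma pigeonhole (X : eqType) (f : nat -> X) (s : seq X) :
  (forall q, f q \in s) -> exists q q', q < q' /\ f q = f q'.
Proof.
move=> fs; apply: contrapT => no.
have : uniq (map f (iota 0 (size s).+1)).
  rewrite map_inj_uniq ?iota_uniq // => q q' E.
  have [qq'|q'q|//] := ltngtP q q'; case: no; first by exists q, q'.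
  by exists q', q.
move=> /uniq_leq_size le; have : size (map f (iota 0 (size s).+1)) <= size s.
  by apply: le => _ /mapP[q _ ->]; exact: fs.
by rewrite size_map size_iota ltnn.
Qed.

(** * Group actions on trees *)

(** The elements g such that x is joined to its image form a subgroup, by
    invariance of E. *)
Lemma conn_orbit (G : groupType) (X : Type) (a : G -> X -> X)
    (E : X -> X -> Prop) (s : seq G) x :
  (forall x, a 1%g x = x) -> (forall g h x, a (g * h)%g x = a g (a h x)) ->
  (forall g y z, generated_by s g -> E y z -> E (a g y) (a g z)) ->
  (forall y z, E y z -> E z y) ->
  (forall g, g \in s -> conn E x (a g x)) ->
  forall g, generated_by s g -> conn E x (a g x).
Proof.
move=> a1 aM Einv Esym sE g sg.
have inv h y z : generated_by s h -> conn E y z -> conn E (a h y) (a h z).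
  by move=> sh; apply: conn_map => y' z'; exact: Einv.
have ss := gen_subgroup s.
suff sub : generated_by s `<=` generated_by s `&` [set g | conn E x (a g x)].
  by have [] := sub g sg.
apply: (@gen_min G s); last first.
  by move=> h hs; split; [exact: gen_mem|exact: sE].
split=> [|h k [sh hx] [sk kx]|h [sh hx]].
- by split; [exact: (sub1 ss)|rewrite /= a1; exact: conn_refl].
- split; first exact: (subM ss sh sk).
  by rewrite /= aM; exact: conn_trans hx (inv _ _ _ sh kx).
- split; first exact: (subV ss sh).
  apply: conn_sym => //.
  by have := inv _ _ _ (subV ss sh) hx; rewrite -aM mulVg a1.
Qed.

Section Actions.
Variables (G : groupType) (T : Gtree G).
Implicit Types (g h k : G) (x y z : T).

Local Notation adj := (@adj G T).
Local Notation act := (@act G T).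
Local Notation d := (gdist adj).
Local Notation H := (half adj).
Let treeP : is_tree adj := adj_tree T.

Lemma adjC : symmetric adj. Proof. by case: treeP. Qed.

Lemma actK g : cancel (act g) (act g^-1%g).
Proof. by move=> x; rewrite -actM mulVg act1. Qed.

Lemma actKV g : cancel (act g^-1%g) (act g).
Proof. by move=> x; rewrite -actM mulgV act1. Qed.

Lemma act_inj g : injective (act g). Proof. exact: can_inj (actK g). Qed.

Lemma act_fixV g x : act g x = x -> act g^-1%g x = x.
Proof. by move=> {1}<-; rewrite actK. Qed.

Lemma act_fixX g n x : act g x = x -> act (g ^+ n)%g x = x.
Proof.
move=> gx; elim: n => [|n IH]; first by rewrite act1.
by rewrite expgS actM IH.
Qed.

Lemma gdist_act g x y : d (act g x) (act g y) = d x y.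
Proof.
suff le h u v : d (act h u) (act h v) <= d u v.
  apply/eqP; rewrite eqn_leq le /=.
  by have := le g^-1%g (act g x) (act g y); rewrite !actK.
have [p [up <- <-]] := gdist_path treeP u v.
rewrite -(size_map (act h)) -last_map; apply: gdist_le => //.
elim: p u up => //= a p IH u /andP[ua ap].
by rewrite act_adj ua IH.
Qed.

Lemma half_act g x y z : H (act g x) (act g y) (act g z) = H x y z.
Proof. by rewrite /half !gdist_act. Qed.

Lemma half_actV g x y z : H x y (act g z) = H (act g^-1%g x) (act g^-1%g y) z.
Proof. by rewrite -[RHS](half_act g) !actKV. Qed.

Lemma line_act g (l : int -> T) : is_line adj l -> is_line adj (act g \o l).
Proof.
by move=> lP i j; apply/(is_distE treeP); rewrite /= gdist_act (line_dist treeP).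
Qed.

Definition fixer x : set G := [set g | act g x = x].

Lemma fixer_subgroup x : is_subgroup (fixer x).
Proof.
split=> [|g h gx hx|g gx]; rewrite /fixer /= ?act1 //.
  by rewrite actM hx.
exact: act_fixV.
Qed.

Lemma edge_stab_subgroup x y : is_subgroup (edge_stab x y).
Proof. exact: subgroupI (fixer_subgroup x) (fixer_subgroup y). Qed.

(** * Consequences of minimality *)

Lemma invariant_all (A : set T) : is_subtree adj A ->
  (forall g x, A x -> A (act g x)) -> forall x, A x.
Proof. by move=> sA iA x; rewrite (act_minimal sA iA). Qed.

(** The intersection of all half-trees that contain the orbit of x is an
    invariant subtree, hence the whole tree; in particular it contains b. *)
Lemma orbit_half x a b : adj a b -> exists g, H a b (act g x).
Proof.
pose A := [set z | forall u v, adj u v -> H u v z -> exists g, H u v (act g x)].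
move=> ab; suff Ab : A b by exact: (Ab a b ab (half_in treeP ab)).
apply: (@invariant_all A) => [|g z Az u v uv].
  apply: (@step_subtree _ _ treeP A).
    by exists x => u v _ h; exists 1%g; rewrite act1.
  move=> y z y' Ay Az yy' hz u v uv hy'.
  case hy : (H u v y); first exact: Ay uv hy.
  have [E1 E2] : y' = v /\ y = u.
    by apply: half_cross (negbT hy) => //; rewrite adjC.
  by apply: Az => //; rewrite -E1 -E2.
rewrite half_actV => /Az[|h]; first by rewrite act_adj.
by move=> hh; exists (g * h)%g; rewrite actM half_actV.
Qed.

Lemma nontrivial_adj : ~ trivial_tree T -> forall x, exists y, adj x y.
Proof.
move=> ntT x; apply: contrapT => nx; apply: ntT; exists x => y.
apply: contrapT => yx; have [u xu _] := half_exists treeP yx.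
by apply: nx; exists u.
Qed.

(** Removing an orbit of leaves from a tree leaves an invariant subtree, which
    is non-empty because there are no inversions. *)
Lemma no_leaf : ~ trivial_tree T ->
  forall x y, adj x y -> exists2 u, adj y u & u <> x.
Proof.
move=> ntT x y xy; apply: contrapT => leaf.
have leafP u : adj y u -> u = x.
  by move=> yu; apply: contrapT => ux; apply: leaf; exists u.
pose A := [set z | forall g, act g y <> z].
suff /(_ y 1%g) : forall z, A z by rewrite act1.
apply: (@invariant_all A) => [|g z Az h E]; last first.
  by apply: (Az (g^-1 * h)%g); rewrite actM E actK.
apply: (@step_subtree _ _ treeP A).
  exists x => g gy; apply: (act_no_inversion xy (g := g)); split=> //.
  have : adj y (act g^-1%g y).
    by rewrite -(act_adj g) actKV gy.
  move=> /leafP E; by rewrite -E actKV.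
move=> z w z' Az Aw zz' hw g gy.
have z'w : w <> z' by move=> E; apply: (Aw g); rewrite gy.
have [u z'u hu] := half_exists treeP z'w.
have leaf' v : adj z' v -> v = act g x.
  rewrite -gy -{1}(actKV g v) act_adj => /leafP <-; by rewrite actKV.
have uz : u = z by rewrite (leaf' u z'u) (leaf' z) // adjC.
by move: hw; rewrite -[H _ _ _]negbK -halfC // -{1}uz ?hu // adjC.
Qed.

(** Since there are no leaves, a half-tree contains half-trees as deep as
    desired, and each of them meets every orbit. *)
Lemma orbit_deep : ~ trivial_tree T -> forall x a b n, adj a b ->
  exists g, H a b (act g x) /\ n <= d a (act g x).
Proof.
move=> ntT x a b n ab.
suff [u [v [uv sub un]]] : exists u v, [/\ adj u v,
    forall z, H u v z -> H a b z & forall z, H u v z -> n <= d a z].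
  have [g hg] := orbit_half x uv.
  by exists g; split; [exact: sub|exact: un].
elim: n => [|n [u [v [uv sub un]]]]; first by exists a, b.
have [w vw wu] := no_leaf ntT uv.
exists v, w; split=> // z hz; first by apply: sub; exact: half_sub hz.
have vw' : d a z = d z w + 1 + d v a.
  have hwv : ~~ H v w a.
    apply/negP => /(half_sub treeP uv vw wu) /sub.
    by rewrite (negPf (half_out treeP _ _)).
  rewrite gdist_sym // (half_dist treeP vw hz hwv).
  by have := gdist_adjP treeP z vw; move: hz; rewrite /half; lia.
have := un v (half_in treeP uv); rewrite vw' (gdist_sym treeP a); lia.
Qed.

(** * Translations *)

Lemma axis_pow g (l : int -> T) (n : int) (q : nat) (i : int) :
  (forall i, act g (l i) = l (i + n)%R) ->
  act (g ^+ q)%g (l i) = l (i + q%:Z * n)%R.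
Proof.
move=> gl; elim: q => [|q IH]; first by rewrite act1; congr l; lia.
by rewrite expgS actM IH gl; congr l; lia.
Qed.

Lemma axisV g (l : int -> T) (n : int) :
  (forall i, act g (l i) = l (i + n)%R) ->
  forall i, act g^-1%g (l i) = l (i - n)%R.
Proof.
move=> gl i; apply: (@act_inj g); rewrite actKV gl; congr l; lia.
Qed.

(** A fixed vertex would stay at constant distance from points of the line
    that go to infinity. *)
Lemma translate_nofix g (l : int -> T) (n : int) x : is_line adj l ->
  (forall i, act g (l i) = l (i + n)%R) -> n <> 0%R -> act g x <> x.
Proof.
move=> lP gl n0 gx; set m := d x (l 0%R).
have := axis_pow (2 * m + 1) 0%R gl.
set q := (2 * m + 1) => E.
have dm : d x (l (0 + q%:Z * n)%R) = m.
  by rewrite -E -{1}(act_fixX q gx) gdist_act.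
have := gdist_tri treeP x (l 0%R) (l (0 + q%:Z * n)%R).
rewrite dm (line_dist treeP lP) (gdist_sym treeP (l 0%R) x) -/m.
have : q <= `|(0 - (0 + q%:Z * n))%R|%N by nia.
rewrite /q; lia.
Qed.

(** If m left l, one of its rays would stay in a half-tree attached to l at a
    single vertex; g or its inverse maps that ray into itself, so it fixes the
    attaching vertex, although a translation has no fixed vertex. *)
Lemma invariant_line g (l m : int -> T) (n : int) : is_line adj l -> is_line adj m ->
  (forall i, act g (m i) = m (i + n)%R) -> n <> 0%R ->
  (forall i, range l (act g (l i))) -> (forall i, range l (act g^-1%g (l i))) ->
  forall i, range l (m i).
Proof.
move=> lP mP gm n0 gl gl' i; apply: contrapT => off.
have [j [u [ju nu hu sep]]] := line_off treeP lP off.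
have [k [kl kl' kh knofix]] : exists k, [/\ forall i, range l (act k (l i)),
    forall i, range l (act k^-1%g (l i)),
    H (l j) u (act k (m i)) & act k (l j) <> l j].
  have nofix := translate_nofix mP gm n0.
  have nofix' x : act g^-1%g x <> x by move=> /act_fixV; rewrite invgK; exact: nofix.
  have [up|dn] := line_ray treeP mP ju hu.
  - have [n_gt0|n_lt0] : (0 < n)%R \/ (n < 0)%R by lia.
      by exists g; split=> //; rewrite gm; apply: up; lia.
    exists g^-1%g; split=> //; first by rewrite invgK.
    by rewrite (axisV gm); apply: up; lia.
  - have [n_gt0|n_lt0] : (0 < n)%R \/ (n < 0)%R by lia.
      exists g^-1%g; split=> //; first by rewrite invgK.
      by rewrite (axisV gm); apply: dn; lia.
    by exists g; split=> //; rewrite gm; apply: dn; lia.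
(* both l j and its translate are the projection of k (m i) to l *)
apply: knofix; have [j' _ Ej'] := kl j.
have sep' : ~~ H (act k (l j)) (act k u) (l j).
  rewrite -[l j as X in ~~ H _ _ X](actKV k) half_act.
  by have [i' _ <-] := kl' j; exact: sep.
have hz : H (act k (l j)) (act k u) (act k (m i)) by rewrite half_act.
have kadj : adj (act k (l j)) (act k u) by rewrite act_adj.
have D1 := half_dist treeP kadj hz sep'.
have D2 := half_dist treeP ju kh (sep j').
rewrite Ej' (gdist_sym treeP (l j)) in D2.
by apply: (gdist_eq0 treeP); lia.
Qed.

End Actions.

(** * Slender groups acting on trees *)

Section SlenderActions.
Variables (G : groupType) (T : Gtree G).
Implicit Types (g h k : G) (x y z : T) (K L : set G).

Local Notation adj := (@adj G T).
Local Notation act := (@act G T).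
Local Notation d := (gdist adj).
Local Notation H := (half adj).
Let treeP : is_tree adj := adj_tree T.

(** An element that fixes x but not the edge [x, x'] moves everything beyond
    this edge to another branch at x. *)
Lemma leave_bridge g x x' y : adj x x' -> H x x' y ->
  act g x = x -> act g x' <> x' -> ~~ H x x' (act g y).
Proof.
move=> xx' hy gx gx'; apply/negP => hgy; apply: gx'.
apply: (half_disj treeP (v := x) (z := act g y)) => //.
  by rewrite -{1}gx act_adj.
by rewrite -{1}gx half_act.
Qed.

(** If the fixed trees of L and g are disjoint, consider the bridge [x, y]
    between them. An element l of L that moves its first edge and the element
    g, which moves its last edge, have a product that translates along the
    bridge, by twice its length. *)
Lemma elliptic_product L g x0 y0 : is_subgroup L ->
  (forall l, L l -> act l x0 = x0) -> act g y0 = y0 ->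
  (exists x, act g x = x /\ forall l, L l -> act l x = x) \/
  exists2 l, L l & forall z, act (g * l)%g z <> z.
Proof.
move=> sL Lx0 gy0.
have [|nofix] := pselect (exists x, act g x = x /\ forall l, L l -> act l x = x).
  by left.
right; pose Q n := `[< exists x y, [/\ forall l, L l -> act l x = x,
  act g y = y & d x y = n] >].
have exQ : exists n, Q n by exists (d x0 y0); apply/asboolP; exists x0, y0.
case: (ex_minnP exQ) => n /asboolP[x [y [Lx gy Exy]]] minn.
have {}minn u v : (forall l, L l -> act l u = u) -> act g v = v -> n <= d u v.
  by move=> Lu gv; apply: minn; apply/asboolP; exists u, v.
have xy : x <> y by move=> E; apply: nofix; exists x; split=> //; rewrite E.
have [x' xx' hy] := half_exists treeP (fun E : y = x => xy (esym E)).
have [y' yy' hx] := half_exists treeP xy.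
have [l [Ll lx']] : exists l, L l /\ act l x' <> x'.
  apply: contrapT => no; have : n <= d x' y.
    apply: minn => // l Ll; apply: contrapT => lx'; apply: no; by exists l.
  by move: hy; rewrite /half !(gdist_sym treeP y) Exy; lia.
have gy' : act g y' <> y'.
  move=> gy'; have : n <= d x y' by exact: minn.
  by move: hx; rewrite /half Exy; lia.
have lx := Lx l Ll.
exists l => // z; rewrite actM => glz.
have dx : d x (act l z) = d x z by rewrite -{1}lx gdist_act.
have dy : d y z = d y (act l z) by rewrite -{1}glz -{1}gy gdist_act.
have sep u : ~~ H y y' u -> H x x' u.
  move=> hu; rewrite -[H x x' u]negbK; apply/negP => hxu.
  have := half_dist treeP yy' hx hu; have := half_dist treeP xx' hy hxu.
  have : d x y <> 0 by move/(gdist_eq0 treeP).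
  by rewrite (gdist_sym treeP x y); lia.
have far u : ~~ H x x' u -> d y u = n + d x u.
  by move=> hu; rewrite (half_dist treeP xx' hy hu) (gdist_sym treeP y) Exy.
have n0 : n <> 0 by rewrite -Exy => /(gdist_eq0 treeP).
(* A fixed point z of the product would satisfy act l z = act g^-1 z. Both
   elements move points across the bridge, and comparing the distances of z
   and of its image to x and y gives a contradiction on either side. *)
have [hz|hz] := boolP (H y y' z).
  have hw : ~~ H y y' (act l z).
    rewrite -(actK g (act l z)) glz; apply: leave_bridge => //.
      exact: act_fixV.
    by move=> /act_fixV; rewrite invgK.
  have hz' : ~~ H x x' z.
    rewrite -(actK l z); apply: leave_bridge => //; first exact: sep.
      exact: act_fixV.
    by move=> /act_fixV; rewrite invgK.
  have := far _ hz'; have := half_dist treeP yy' hx hw.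
  by rewrite Exy; lia.
have := far _ (leave_bridge xx' (sep _ hz) lx lx').
have := half_dist treeP yy' hx hz; rewrite Exy; lia.
Qed.

(** Serre's lemma, by induction on the number of generators. *)
Lemma fg_elliptic (s : seq G) :
  (forall g, generated_by s g -> exists x, act g x = x) ->
  exists x, forall g, generated_by s g -> act g x = x.
Proof.
elim: s => [|a s IH] ell.
  have [_ _ [x _] _ _] := treeP; exists x => g g1.
  have sg1 : is_subgroup [set 1%g : G].
    split=> [|g' h -> ->|g' ->] //=; first by rewrite mulg1.
    by rewrite invg1.
  have -> : g = 1%g; last exact: act1.
  exact: (gen_min (s := [::]) sg1 (fun _ _ => ltac:(done)) g1).
have sub : generated_by s `<=` generated_by (a :: s).
  apply: gen_min; first exact: gen_subgroup.
  by move=> g gs; apply: gen_mem; rewrite inE gs orbT.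
have [x0 sx0] := IH (fun g sg => ell g (sub g sg)).
have sa : generated_by (a :: s) a by apply: gen_mem; exact: mem_head.
have [y0 ay0] := ell a sa.
have [[x [ax sx]]|[l sl hyp]] := elliptic_product (gen_subgroup s) sx0 ay0.
  exists x => g; apply: (gen_min (fixer_subgroup x) (s := a :: s)) => h.
  by rewrite inE => /orP[/eqP->|/(@gen_mem _ _ _)/sx].
have [z] := ell (a * l)%g (subM (gen_subgroup _) sa (sub l sl)).
by move/hyp.
Qed.

(** Integer powers, needed to parametrize an axis. *)
Definition zpow g (q : int) : G :=
  match q with Posz n => (g ^+ n)%g | Negz n => (g ^- n.+1)%g end.

Lemma zpowS g q : zpow g (q + 1)%R = (zpow g q * g)%g.
Proof.
case: q => [n|[|n]].
- by rewrite (_ : (Posz n + 1)%R = n.+1) ?[LHS]expgSr //; lia.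
- by rewrite /= expg1 mulVg.
have -> : (Negz n.+1 + 1)%R = Negz n by lia.
by rewrite /= [in RHS]expgS invgM -mulgA mulVg mulg1.
Qed.

Lemma zpowSl g q : zpow g (q + 1)%R = (g * zpow g q)%g.
Proof.
case: q => [n|[|n]].
- by rewrite (_ : (Posz n + 1)%R = n.+1) ?[LHS]expgS //; lia.
- by rewrite /= expg1 mulgV.
have -> : (Negz n.+1 + 1)%R = Negz n by lia.
by rewrite /= [in RHS]expgSr invgM mulgA mulgV mul1g.
Qed.

(** The axis is the union of the translates of a segment [x, gx] of minimal
    length: backtracking where two of them meet would produce a point moved by
    a smaller distance, or an inversion. *)
Lemma axis_exists g : (forall x, act g x <> x) -> exists (l : int -> T) (n : int),
  [/\ is_line adj l, (0 < n)%R & forall i, act g (l i) = l (i + n)%R].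
Proof.
move=> hyp; have [_ _ [x0 _] _ _] := treeP.
pose Q n := `[< exists x, d x (act g x) = n >].
have exQ : exists n, Q n by exists (d x0 (act g x0)); apply/asboolP; exists x0.
case: (ex_minnP exQ) => n /asboolP[x Ex] minn.
have {}minn y : n <= d y (act g y) by apply: minn; apply/asboolP; exists y.
have [p [xp lp sp]] := gdist_path treeP x (act g x).
rewrite Ex in sp; pose c i := nth x (x :: p) i.
have cadj i : i < n -> adj (c i) (c i.+1).
  by move=> ip; have /(pathP x) := xp; apply; rewrite sp.
have cn : c n = act g x by rewrite /c -sp -lp (last_nth x).
have n0 : 0 < n.
  by rewrite lt0n -Ex; apply/eqP => /(gdist_eq0 treeP) E; exact: (hyp x).
have cle i m : i + m <= n -> d (c i) (c (i + m)) <= m.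
  elim: m => [|m IH] im; first by rewrite addn0 gdistxx.
  have := gdist_adj_le treeP (c i) (cadj (i + m) ltac:(lia)).
  have := IH ltac:(lia); rewrite addnS; lia.
pose l (i : int) := act (zpow g (i %/ Posz n)%Z) (c `|(i %% Posz n)%Z|%N).
have nz : Posz n <> 0%R by lia.
have lE q r : r <= n -> l (q * n%:Z + r%:Z)%R = act (zpow g q) (c r).
  rewrite leq_eqVlt => /orP[/eqP->|rn].
    rewrite /l cn (_ : (q * n%:Z + n%:Z)%R = ((q + 1) * n%:Z)%R); last by lia.
    by rewrite mulzK ?modzMl; [rewrite zpowS actM|exact/eqP].
  rewrite /l divzMDl; last exact/eqP.
  by rewrite modzMDl divz_small ?modz_small ?addr0 //; lia.
have decomp i : exists q r, r < n /\ i = (q * n%:Z + r%:Z)%R.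
  exists (i %/ Posz n)%Z, `|(i %% Posz n)%Z|%N.
  have := modz_ge0 i (introN eqP nz); have := ltz_pmod i (d := Posz n) ltac:(lia).
  have := divz_eq i (Posz n); lia.
have gl i : act g (l i) = l (i + n%:Z)%R.
  have [q [r [rn ->]]] := decomp i.
  have -> : (q * n%:Z + r%:Z + n%:Z = (q + 1) * n%:Z + r%:Z)%R by lia.
  by rewrite !lE ?(ltnW rn) // zpowSl actM.
exists l, (Posz n); split; [|by lia|exact: gl].
apply: local_line => // i; have [q [r [rn ->]]] := decomp i.
  have -> : (q * n%:Z + r%:Z + 1 = q * n%:Z + r.+1%:Z)%R by lia.
  by rewrite !lE ?(ltnW rn) // act_adj; exact: cadj.
(* Backtracking within a translate of the segment contradicts its being
   geodesic, and between two translates the minimality of its length. *)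
have [r2|r2] : (r.+2 <= n)%N \/ r.+1 = n by lia.
  have -> : (q * n%:Z + r%:Z + 2 = q * n%:Z + r.+2%:Z)%R by lia.
  rewrite !lE ?(ltnW rn) // => /act_inj E.
  have := cle 0 r ltac:(lia); have := cle r.+2 (n - r.+2) ltac:(lia).
  rewrite -E add0n (_ : r.+2 + (n - r.+2) = n) ?cn; last by lia.
  have := gdist_tri treeP (c r) x (act g x); rewrite Ex -[c 0]/x; lia.
have -> : (q * n%:Z + r%:Z + 2 = (q + 1) * n%:Z + 1%:Z)%R by lia.
rewrite !lE ?(ltnW rn) // zpowS actM => /act_inj E.
case: r rn r2 E => [|r] rn r2 E.
  have n1 : n = 1 by lia.
  rewrite n1 in cn; rewrite cn in E.
  by apply: (act_no_inversion (cadj 0 n0) (g := g)); rewrite cn -E.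
have := minn (c 1); rewrite -E.
have := cle 1 r ltac:(lia); rewrite add1n; lia.
Qed.

(** Ping-pong. The set B receives its complement under the non-trivial
    elements of A, and is moved off itself by the positive powers of b. Then
    the conjugates of A by the powers of b generate their free product, which
    has a strictly ascending chain of subgroups; this is impossible inside a
    slender group. *)
Section PingPong.
Variables (K A : set G) (b : G) (B : T -> bool).
Hypotheses (slK : slender K) (sK : is_subgroup K).
Hypotheses (sA : is_subgroup A) (AK : A `<=` K) (Kb : K b).
Hypothesis A_move : forall g z, A g -> g <> 1%g -> ~~ B z -> B (act g z).
Hypothesis b_move : forall j z, 0 < j -> B z -> ~~ B (act (b ^+ j)%g z).

(** Reduced words in the first conjugates of A. The first index is the one of
    the leftmost factor, so that consecutive factors belong to different
    conjugates. *)
Inductive reduced (n : nat) : option nat -> G -> Prop :=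
| reduced1 : reduced n None 1%g
| reducedM j g o w : j <= n -> A g -> g <> 1%g -> reduced n o w ->
    o <> Some j -> reduced n (Some j) (b ^+ j * g * b ^- j * w)%g.

Lemma translates_disjoint i j z :
  B (act (b ^- i)%g z) -> B (act (b ^- j)%g z) -> i = j.
Proof.
have aux m n : B (act (b ^- m)%g z) -> B (act (b ^- n)%g z) -> ~ m < n.
  move=> Bm Bn mn; have mn' : 0 < n - m by rewrite subn_gt0.
  have /negP := b_move mn' Bn; rewrite -actM; apply.
  suff -> : (b ^+ (n - m) * b ^- n)%g = (b ^- m)%g by [].
  apply: (@mulIg _ (b ^+ n)%g); rewrite -mulgA mulVg mulg1.
  apply: (@mulgI _ (b ^+ m)%g).
  by rewrite mulgA mulgV mul1g -expgnDr subnKC // ltnW.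
by move=> Bi Bj; have := aux i j Bi Bj; have := aux j i Bj Bi; lia.
Qed.

(** The ping-pong argument itself: a reduced word sends a point outside all
    translates of B into the translate that corresponds to its leftmost
    factor. *)
Lemma reduced_move n o w x : reduced n o w ->
  (forall j, ~~ B (act (b ^- j)%g x)) ->
  match o with
  | None => act w x = x
  | Some j => j <= n /\ B (act (b ^- j)%g (act w x))
  end.
Proof.
move=> red outx; elim: red => [|j g {}o {}w jn Ag g1 _ IH oj]; first exact: act1.
split=> //; rewrite -actM !mulgA mulVg mul1g -mulgA actM.
apply: A_move => //; rewrite actM; case: o oj IH => [k|] oj; last by move=> ->.
by move=> [_ Bk]; apply/negP => Bj; apply: oj; rewrite (translates_disjoint Bk Bj).
Qed.

Lemma reduced_mul n j g o w : j <= n -> A g -> reduced n o w ->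
  exists o', reduced n o' (b ^+ j * g * b ^- j * w)%g.
Proof.
move=> jn Ag red.
have [->|g1] := pselect (g = 1%g).
  by exists o; rewrite mulg1 mulgV mul1g.
case: red => [|i h o' w' iN Ah h1 red' oi].
  by exists (Some j); apply: (reducedM jn Ag g1 (reduced1 n)).
have [ij|ij] := eqVneq i j; last first.
  exists (Some j); apply: (reducedM jn Ag g1 (reducedM iN Ah h1 red' oi)).
  by move=> [E]; move: ij; rewrite E eqxx.
rewrite ij in oi *.
have -> : (b ^+ j * g * b ^- j * (b ^+ j * h * b ^- j * w') =
           b ^+ j * (g * h) * b ^- j * w')%g.
  by rewrite !mulgA mulgVK.
have [->|gh1] := pselect ((g * h)%g = 1%g).
  by exists o'; rewrite mulg1 mulgV mul1g.
exists (Some j); exact: (reducedM jn (subM sA Ag Ah) gh1 red' oi).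
Qed.

(** By the chain condition, a conjugate of a by a large power of b is a
    product of conjugates by smaller powers, hence a reduced word in these;
    the two elements send x to different translates of B. *)
Lemma ping_pong a x : A a -> a <> 1%g ->
  (forall j, ~~ B (act (b ^- j)%g x)) -> False.
Proof.
move=> Aa a1 outx.
pose base n := [set (b ^+ j * g * b ^- j)%g | j in [set j | j <= n] & g in A].
pose U n : set G := smallest (@is_subgroup G) (base n).
have sU n : is_subgroup (U n).
  split=> [L [sL _]|g h Ug Uh L sL|g Ug L sL].
  - exact: sub1.
  - by apply: subM; [case: sL|exact: Ug|exact: Uh].
  - by apply: subV; [case: sL|exact: Ug].
have baseK n : base n `<=` K.
  move=> _ [j _ [g Ag <-]]; apply: subM => //; last exact: (subV sK (subX j sK Kb)).
  by apply: subM => //; [exact: subX|exact: AK].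
have [n Un] : exists n, forall m, U m `<=` U n.
  apply: slender_chain slK sU _ _ => n; first by move=> g; apply; split=> //; exact: baseK.
  move=> g Ug L [sL baseL]; apply: Ug; split=> // h [j jn [k Ak <-]].
  by apply: baseL; exists j; [exact: leqW|exists k].
pose red := [set w | exists o, reduced n o w].
pose V := [set g | forall w, red w -> red (g * w)%g /\ red (g^-1 * w)%g].
have sV : is_subgroup V.
  split=> [w|g h Vg Vh w rw|g Vg w rw]; first by rewrite invg1 mul1g.
  - split; first by rewrite -mulgA; apply Vg; apply Vh.
    by rewrite invgM -mulgA; apply Vh; apply Vg.
  - by rewrite invgK; have [] := Vg w rw.
have UV : U n `<=` V.
  move=> g; apply; split=> // h [j jn [k Ak <-]] w [o rw]; split.
    exact: reduced_mul rw.
  rewrite !invgM invgK mulgA; apply: reduced_mul rw => //; exact: subV.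
have [] : red (b ^+ n.+1 * a * b ^- n.+1)%g.
  rewrite -[X in red X]mulg1; apply UV; last by exists None; exact: reduced1.
  apply: (Un n.+1); move=> L [sL]; apply; exists n.+1 => //=.
  by exists a.
move=> o /reduced_move /(_ outx) redx.
have Ba : B (act (b ^- n.+1)%g (act (b ^+ n.+1 * a * b ^- n.+1)%g x)).
  by rewrite -actM !mulgA mulVg mul1g actM; apply: A_move.
case: o redx => [j [jn Bj]|E].
  by have := translates_disjoint Ba Bj; move: jn; lia.
by move: Ba; rewrite E (negPf (outx _)).
Qed.

End PingPong.

End SlenderActions.

Section SlenderCore.
Variables (G : groupType) (T : Gtree G).
Implicit Types (g h k : G) (x y z : T) (K L : set G).

Local Notation adj := (@adj G T).
Local Notation act := (@act G T).
Local Notation d := (gdist adj).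
Local Notation H := (half adj).
Let treeP : is_tree adj := adj_tree T.

Lemma line_side (l : int -> T) v w (i j : int) : is_line adj l -> adj v w ->
  ~ range l v -> H v w (l i) = H v w (l j).
Proof.
move=> lP vw nv.
suff aux a b : H v w (l a) -> H v w (l b) by apply/idP/idP; exact: aux.
move=> ha; apply: contrapT => /negP hb; apply: nv.
have [ab|ba] : (a <= b)%R \/ (b <= a)%R by lia.
  have [m [_ _ hm hm']] := int_cross (P := H v w \o l) ab ha hb.
  have [_ <-] := half_cross treeP vw (line_adj treeP lP m) hm hm'.
  by exists (m + 1)%R.
have [m [_ _ /= hm hm']] :=
  int_cross (P := fun m => ~~ H v w (l m)) ba hb (introT negPn ha).
have mm : adj (l (m + 1)%R) (l m) by rewrite adjC line_adj.
have [_ <-] := half_cross treeP vw mm (negbNE hm') hm.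
by exists m.
Qed.

(** Seen from a vertex beyond the edge [v, w], everything on the other side
    appears as it does from v. *)
Lemma half_shadow v w x y z : adj v w -> H v w z ->
  ~~ H v w x -> ~~ H v w y -> H x y z = H x y v.
Proof.
move=> vw hz hx hy.
by rewrite /half (half_dist treeP vw hz hx) (half_dist treeP vw hz hy) ltn_add2l.
Qed.

Lemma half_axis g (l : int -> T) (n i : int) (q : nat) z :
  (forall i, act g (l i) = l (i + n)%R) ->
  H (l (i + q%:Z * n)%R) (l (i + q%:Z * n + 1)%R) (act (g ^+ q)%g z) =
  H (l i) (l (i + 1)%R) z.
Proof.
move=> gl; rewrite -[RHS](half_act (g ^+ q)%g) !(axis_pow q _ gl).
by congr (H _ (l _) _); lia.
Qed.

(** If the axes of k and k' diverge in both directions, then the axis of k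
    avoids two half-trees far out on the axis of k'. They make up a set B that
    is the complement of a fundamental domain of a power of k', and that
    projects to a bounded part of the axis of k, so powers of k and k' play
    ping-pong. *)
Lemma diverging_axes K k k' (l l' : int -> T) (n n' R : int) :
  slender K -> is_subgroup K -> K k -> K k' ->
  is_line adj l -> is_line adj l' -> (0 < n)%R -> (0 < n')%R ->
  (forall i, act k (l i) = l (i + n)%R) ->
  (forall i, act k' (l' i) = l' (i + n')%R) ->
  (forall i : int, (R < i)%R \/ (i < - R)%R -> ~ range l (l' i)) -> False.
Proof.
move=> slK sK Kk Kk' lP lP' n0 n0' kl kl' off.
have ladj' i := line_adj treeP lP' i; have ladj i := line_adj treeP lP i.
pose h' i z := H (l' i) (l' (i + 1)%R) z; pose h i z := H (l i) (l (i + 1)%R) z.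
have mono i j z : (i <= j)%R -> h j z -> h i z by exact: line_half_mono.
have mono' i j z : (i <= j)%R -> h' j z -> h' i z by exact: line_half_mono.
have [r0 [s0 [_ hr0 hs0]]] := line_half_bound treeP lP' (l 0%R).
have [r [r_r0 r_R]] : exists r, (r0 <= r)%R /\ (R < r)%R.
  by exists (if (r0 <= R)%R then (R + 1)%R else r0); case: ifP; lia.
have [s [s_s0 s_R]] : exists s, [/\ (s <= s0)%R, (s < - R)%R & (s < r)%R].
  pose m := if (- R <= r)%R then (- R)%R else r.
  exists (if (m <= s0)%R then (m - 1)%R else s0).
  by rewrite /m; do 2 case: ifP; split; lia.
move=> s_r.
have lr i : ~~ h' r (l i).
  rewrite /h' -(line_side 0%R i lP (ladj' r)); last by apply: off; left.
  by apply: contra hr0; apply: mono'.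
have ls i : h' s (l i).
  rewrite /h' -(line_side 0%R i lP (ladj' s)); last by apply: off; right.
  exact: mono' hs0.
pose B z := h' r z || ~~ h' s z.
have lB i : ~~ B (l i) by rewrite /B (negPf (lr i)) ls.
have [i1 [i2 band]] : exists i1 i2, forall z, B z -> h i1 z && ~~ h i2 z.
  have [r1 [s1 [_ hr1 hs1]]] := line_half_bound treeP lP (l' r).
  have [r2 [s2 [_ hr2 hs2]]] := line_half_bound treeP lP (l' (s + 1)%R).
  exists (if (s1 <= s2)%R then s1 else s2), (if (r1 <= r2)%R then r2 else r1).
  move=> z /orP[hz|hz].
    have E i : h i z = h i (l' r) by exact: (half_shadow (ladj' r) hz (lr i) (lr (i + 1)%R)).
    apply/andP; split; [|apply: contra hr1]; rewrite E.
      by apply: mono hs1; case: ifP; lia.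
    by apply: mono; case: ifP; lia.
  have sadj : adj (l' (s + 1)%R) (l' s) by rewrite adjC.
  have E i : h i z = h i (l' (s + 1)%R).
    by apply: (half_shadow sadj); rewrite halfC // -/(h' s _) ?negbK ?ls.
  apply/andP; split; [|apply: contra hr2]; rewrite E.
    by apply: mono hs2; case: ifP; lia.
  by apply: mono; case: ifP; lia.
(* The exponents make the translation lengths exceed the length of the part of
   the axis of k onto which B projects, and of the part of the axis of k'
   outside B. *)
pose b := (k ^+ `|i2 - i1|.+1)%g; pose a := (k' ^+ `|r - s|)%g.
have Kb : K b by exact: subX.
have Ka : K a by exact: subX.
have sA := powers_subgroup a.
have AK : [set (a ^+ m / a ^+ p)%g | m in setT & p in setT] `<=` K.
  by move=> _ [m _ [p _ <-]]; exact: (subM sK (subX m sK Ka) (subV sK (subX p sK Ka))).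
have amove m z : 0 < m -> ~~ B z -> B (act (a ^+ m)%g z) /\ B (act (a ^- m)%g z).
  move=> m0; rewrite negb_or negbK => /andP[hr hs].
  have E q z' : h' (q + m%:Z * (`|r - s|%N%:Z * n'))%R (act (a ^+ m)%g z') = h' q z'.
    rewrite -expgnA /h' mulrA -PoszM mulnC; exact: half_axis.
  have far : (r <= s + m%:Z * (`|r - s|%N%:Z * n'))%R.
    rewrite mulrCA; have : (1 <= m%:Z * n')%R by nia.
    by move: (m%:Z * n')%R => p; nia.
  split; apply/orP.
    left; apply: (mono' _ (s + m%:Z * (`|r - s|%N%:Z * n'))%R) => //.
    by rewrite E.
  right; apply: contra hr.
  rewrite -(E s) actKV; exact: mono'.
have bmove j z : 0 < j -> B z -> ~~ B (act (b ^+ j)%g z).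
  move=> j0 /band /andP[h1 _]; apply/negP => /band /andP[_ /negP]; apply.
  apply: (mono _ (i1 + (`|i2 - i1|.+1 * j)%N%:Z * n)%R); first by nia.
  by rewrite /h -expgnA half_axis.
have aE : a <> 1%g.
  move=> E; have [+ _] := amove 1 (l 0%R) isT (lB _).
  by rewrite expg1 E act1 (negPf (lB _)).
apply: (ping_pong slK sK sA AK Kb _ bmove _ aE (x := l 0%R)).
- move=> _ z [m _ [p _ <-]] mp Bz; have [pm|] := leqP p m.
    rewrite -expgnFr //; apply: (amove _ _ _ Bz).1.
    rewrite lt0n; apply/eqP => E; apply: mp.
    by rewrite -expgnFr // E.
  move=> m_p; rewrite -[X in act X z]invgK invgM invgK -expgnFr ?(ltnW m_p) //.
  by apply: (amove _ _ _ Bz).2; rewrite subn_gt0.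
- by exists 1 => //; exists 0 => //; rewrite expg1 expg0 invg1 mulg1.
- move=> j; suff [i ->] : exists i, act (b ^- j)%g (l 0%R) = l i by exact: lB.
  rewrite -expVgn /b; exists (- (`|i2 - i1|.+1 * j)%N%:Z * n)%R.
  rewrite expVgn -expgnA; apply: (@act_inj _ _ (k ^+ (`|i2 - i1|.+1 * j))%g).
  by rewrite actKV (axis_pow _ _ kl); congr l; lia.
Qed.

(** Let k push the common ray of the two axes into itself. The pointwise
    stabilizers of the subrays form an ascending chain whose terms are
    conjugate under k; by slenderness they are all equal, so that an element
    fixing a subray fixes the whole axis of k. This applies to the quotient of
    k' by k, hence k' preserves the axis of k. *)
Lemma asymptotic_axes K k k' (l l' : int -> T) (n i0 : int) :
  slender K -> is_subgroup K -> K k -> K k' ->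
  is_line adj l -> is_line adj l' -> (0 < n)%R ->
  (forall i, act k (l i) = l (i + n)%R) ->
  (forall i, act k' (l' i) = l' (i + n)%R) ->
  (forall i : int, (i0 <= i)%R -> l' i = l i) -> forall i, range l (l' i).
Proof.
move=> slK sK Kk Kk' lP lP' n0 kl kl' ray.
(* The pointwise stabilizer of the ray starting at l j. *)
pose F (j : int) := K `&` [set g | forall m : int, (j <= m)%R -> act g (l m) = l m].
have sF j : is_subgroup (F j).
  apply: subgroupI => //; split=> [m _|g g' gF gF' m jm|g gF m jm].
  - exact: act1.
  - by rewrite actM gF' // gF.
  - by apply: act_fixV; exact: gF.
have [q Fq] : exists q : nat, forall m : nat,
    F (i0 + m%:Z * n)%R `<=` F (i0 + q%:Z * n)%R.
  apply: (slender_chain (P := fun m : nat => F (i0 + m%:Z * n)%R) slK) => //.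
    by move=> m g [].
  by move=> m g [Kg gF]; split=> // p mp; apply: gF; nia.
set J := (i0 + q%:Z * n)%R in Fq.
have Fconj (t : nat) j g : F j g -> F (j + t%:Z * n)%R (k ^+ t * g * k ^- t)%g.
  move=> [Kg gF]; split.
    apply: subM => //; last exact: (subV sK (subX t sK Kk)).
    by apply: subM => //; exact: subX.
  move=> m jm; have -> : l m = act (k ^+ t)%g (l (m - t%:Z * n)%R).
    by rewrite (axis_pow _ _ kl); congr l; lia.
  by rewrite -!actM mulgVK actM gF //; lia.
have FconjV (t : nat) j g : K g -> F j (k ^+ t * g * k ^- t)%g ->
    F (j - t%:Z * n)%R g.
  move=> Kg [_ gF]; split=> // m jm; apply: (@act_inj _ _ (k ^+ t)%g).
  have := gF (m + t%:Z * n)%R ltac:(lia).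
  by rewrite -(axis_pow t m kl) -!actM mulgVK.
pose c := (k^-1 * k')%g.
have Kc : K c by apply: subM => //; exact: subV.
have cF (t : nat) : F (J - t%:Z * n)%R c.
  elim: t => [|t IH].
    split=> // m Jm; rewrite /c actM -ray; last by rewrite /J in Jm; nia.
    rewrite kl' ray; last by rewrite /J in Jm; nia.
    rewrite (axisV kl) ray; last by rewrite /J in Jm; nia.
    by congr l; lia.
  apply: FconjV => //; apply: (Fq q.+1).
  have -> : (i0 + q.+1%:Z * n = (J - t%:Z * n) + t.+1%:Z * n)%R by rewrite /J; lia.
  exact: Fconj.
have cl i : act c (l i) = l i.
  by apply: (cF `|J - i|%N).2; nia.
have k'l i : act k' (l i) = l (i + n)%R.
  by rewrite -kl -[in RHS]cl -actM /c mulVKg.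
apply: (invariant_line lP lP' kl') => [|i|i]; first by lia.
  by rewrite k'l; exists (i + n)%R.
by rewrite (axisV k'l); exists (i - n)%R.
Qed.

(** A common ray is traversed by both lines at unit speed, in the same
    direction or in opposite ones. *)
Lemma asymptotic_param (l l' : int -> T) (i0 : int) :
  is_line adj l -> is_line adj l' ->
  (forall i : int, (i0 <= i)%R -> range l (l' i)) ->
  exists c, (forall i : int, (i0 <= i)%R -> l' i = l (i + c)%R) \/
            (forall i : int, (i0 <= i)%R -> l' i = l (- i + c)%R).
Proof.
move=> lP lP' ray.
have [a _ Ea] := ray i0 ltac:(lia); have [b _ Eb] := ray (i0 + 1)%R ltac:(lia).
have dist i j u v : l u = l' i -> l v = l' j -> `|u - v|%N = `|i - j|%N.
  by move=> E E'; rewrite -(line_dist treeP lP) E E' (line_dist treeP lP').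
have Dab := dist _ _ _ _ Ea Eb.
have [ab|ab] : b = (a + 1)%R \/ b = (a - 1)%R by lia.
  exists (a - i0)%R; left=> i ii; have [u _ Eu] := ray i ii.
  rewrite -Eu; congr l.
  have := dist _ _ _ _ Ea Eu; have := dist _ _ _ _ Eb Eu; lia.
exists (a + i0)%R; right=> i ii; have [u _ Eu] := ray i ii.
rewrite -Eu; congr l.
have := dist _ _ _ _ Ea Eu; have := dist _ _ _ _ Eb Eu; lia.
Qed.

Lemma overlap_convex (l l' : int -> T) : is_line adj l -> is_line adj l' ->
  forall i m j : int, (i <= m)%R -> (m <= j)%R ->
  range l (l' i) -> range l (l' j) -> range l (l' m).
Proof.
move=> lP lP' i m j im mj [a _ Ea] [b _ Eb]; apply: contrapT => off.
have [v [u [vu _ hm sep]]] := line_off treeP lP off.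
have [up|dn] := line_ray treeP lP' vu hm.
  by have := up j mj; rewrite -Eb (negPf (sep _)).
by have := dn i im; rewrite -Ea (negPf (sep _)).
Qed.

(** If all elements are elliptic, Serre's lemma gives a fixed vertex.
    Otherwise consider the axis of a hyperbolic element and one of its
    translates. They cannot diverge in both directions, by ping-pong, and if
    they have a common ray they are equal, by the chain condition. *)
Lemma slender_core K : is_subgroup K -> slender K ->
  (exists x, forall g, K g -> act g x = x) \/
  exists l : int -> T, is_line adj l /\
    forall g i, K g -> range l (act g (l i)).
Proof.
move=> sK slK; have [ell|/existsNP[k /not_implyP[Kk hyp]]] :=
  pselect (forall g, K g -> exists x, act g x = x).
  have [[s Ks] _] := slK; left; rewrite Ks; apply: fg_elliptic.
  by rewrite -Ks.
right; have [x kx|l [n [lP n0 kl]]] := @axis_exists _ T k.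
  by apply: hyp; exists x.
exists l; split=> // g i0 Kg; apply: contrapT => off.
pose k' := (g * k * g^-1)%g; pose l' := act g \o l.
have Kk' : K k' by apply: subM; [|apply: subM|apply: subV].
have lP' : is_line adj l' by exact: line_act.
have kl' i : act k' (l' i) = l' (i + n)%R.
  by rewrite /l' /= -kl -!actM /k' mulgVK.
have asym (m : int -> T) k1 : is_line adj m -> K k1 ->
    (forall i, act k1 (m i) = m (i + n)%R) ->
    (forall i, exists j, l' i = m j) ->
    forall a : int, ~ (forall i : int, (a <= i)%R -> range l (m i)).
  move=> mP Kk1 k1m l'm a ray.
  have [c cE] := asymptotic_param lP mP ray.
  suff rm j : range l (m j).
    by apply: off; have [j Ej] := l'm i0; rewrite -[act g _]/(l' i0) Ej.
  case: cE => E.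
    have lP1 := line_shift treeP lP c.
    have kl1 i : act k (l (i + c)%R) = l (i + n + c)%R by rewrite kl; congr l; lia.
    have [u _ <-] := asymptotic_axes slK sK Kk Kk1 lP1 mP n0 kl1 k1m E j.
    by exists (u + c)%R.
  have lP1 : is_line adj (fun i => l (- i + c)%R).
    by move=> i i'; apply/(is_distE treeP); rewrite (line_dist treeP lP); lia.
  have kl1 i : act k^-1%g (l (- i + c)%R) = l (- (i + n) + c)%R.
    by rewrite (axisV kl); congr l; lia.
  have [u _ <-] := asymptotic_axes slK sK (subV sK Kk) Kk1 lP1 mP n0 kl1 k1m E j.
  by exists (- u + c)%R.
have [[R bR]|unb] := pselect (exists R : int,
    forall i : int, (R < i)%R \/ (i < - R)%R -> ~ range l (l' i)).
  exact: (diverging_axes slK sK Kk Kk' lP lP' n0 n0 kl kl' bR).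
have conv := overlap_convex lP lP'.
have [up|down] : (forall R : int, exists i, (R < i)%R /\ range l (l' i)) \/
                 (forall R : int, exists i, (i < R)%R /\ range l (l' i)).
  apply: contrapT => /not_orP[/existsNP[R1 n1] /existsNP[R2 n2]].
  apply: unb; exists (`|R1| + `|R2|)%R => i [ii|ii] ri.
    by apply: n1; exists i; split=> //; lia.
  by apply: n2; exists i; split=> //; lia.
- have [i1 [_ ri1]] := up 0%R.
  apply: (asym l' k' lP' Kk' kl' _ i1) => [i|i ii]; first by exists i.
  by have [i2 [ii2 ri2]] := up i; apply: (conv i1 i i2) => //; lia.
- have [i1 [_ ri1]] := down 0%R.
  have kr i : act k'^-1%g (l' (- i)%R) = l' (- (i + n))%R.
    by rewrite (axisV kl'); congr l'; lia.
  apply: (asym _ _ (line_rev treeP lP') (subV sK Kk') kr _ (- i1)%R) => [i|i ii].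
    by exists (- i)%R; congr l'; lia.
  by have [i2 [ii2 ri2]] := down (- i)%R; apply: (conv i2 (- i)%R i1) => //; lia.
Qed.

End SlenderCore.

(** * Finiteness modulo the group *)

Section Cofinite.
Variables (G : groupType) (T : Gtree G).
Implicit Types (g h k : G) (x y z u v w : T) (K : set G) (N : set T).

Local Notation adj := (@adj G T).
Local Notation act := (@act G T).
Local Notation d := (gdist adj).
Local Notation H := (half adj).
Let treeP : is_tree adj := adj_tree T.

(** The edges of paths from x0 to its images under generators span an
    invariant subtree, because the images of x0 are all joined to x0. By
    minimality these edges join any two vertices, in particular the endpoints
    of an edge, and an edge of a tree cannot be bypassed. *)
Lemma edge_orbits : finitely_generated [set: G] ->
  exists L : seq (T * T), forall x y, adj x y -> exists g e,
    [/\ e \in L, adj e.1 e.2, act g e.1 = x & act g e.2 = y].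
Proof.
move=> [s Gs]; have [_ _ [x0 _] _ _] := treeP.
pose E (L : seq (T * T)) x y := exists g e,
  [/\ e \in L, adj e.1 e.2 & (x, y) = (act g e.1, act g e.2) \/
                             (x, y) = (act g e.2, act g e.1)].
have Emono L L' : {subset L <= L'} -> forall x y, E L x y -> E L' x y.
  by move=> LL' x y [g [e [/LL' eL' e12 xy]]]; exists g, e.
have Esym L x y : E L x y -> E L y x.
  by move=> [g [e [eL e12 [[-> ->]|[-> ->]]]]]; exists g, e; split=> //; [right|left].
have Einv L g x y : E L x y -> E L (act g x) (act g y).
  move=> [h [e [eL e12 [[-> ->]|[-> ->]]]]]; exists (g * h)%g, e; split=> //.
    by left; rewrite !actM.
  by right; rewrite !actM.
have EadjL L x y : E L x y -> adj x y.
  by move=> [g [e [_ e12 [[-> ->]|[-> ->]]]]]; rewrite act_adj // adjC.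
have [L sL] : exists L, forall g, g \in s -> conn (E L) x0 (act g x0).
  apply: (collect (Q := fun g L => conn (E L) x0 (act g x0))) => [g L L' LL'|g _].
    by apply: conn_mono; exact: Emono.
  have [p [xp <- _]] := gdist_path treeP x0 (act g x0).
  elim: p x0 xp => [|y p IH] x /=; first by exists [::]; exact: conn_refl.
  move=> /andP[xy /IH[L EL]]; exists ((x, y) :: L); apply: (@conn_trans _ _ _ y).
    by apply: conn_step; exists 1%g, (x, y); rewrite !act1 mem_head; split=> //; left.
  by apply: conn_mono EL; apply: Emono => e eL; rewrite inE eL orbT.
have G0 g : conn (E L) x0 (act g x0).
  apply: (@conn_orbit _ _ act _ s) => //; try exact: act1; try exact: actM.
  - by move=> h y z _; exact: Einv.
  - exact: Esym.
  - by rewrite -Gs.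
have all x : conn (E L) x0 x.
  apply: (@invariant_all _ T (fun z => conn (E L) x0 z)) => [|g z z0]; last first.
    apply: conn_trans (G0 g) _; move: z0; apply: conn_map => a b; exact: Einv.
  split=> [|y z y0 z0]; first by exists x0; exact: conn_refl.
  have yz : conn (E L) y z.
    by apply: conn_trans z0; apply: conn_sym y0; exact: Esym.
  pose P z := conn (E L) x0 z /\ exists p, [/\ path adj y p, last y p = z &
    forall w, w \in p -> conn (E L) x0 w].
  suff [] : P z by [].
  apply: (yz P); last by split=> //; exists [::].
  move=> a b [a0 [p [yp lp pE]]] Eab.
  have b0 : conn (E L) x0 b by exact: conn_trans a0 (conn_step Eab).
  split=> //; exists (rcons p b); split; rewrite ?last_rcons //.
    by rewrite rcons_path yp lp; exact: EadjL Eab.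
  by move=> w; rewrite mem_rcons inE => /orP[/eqP->|/pE].
exists (L ++ [seq (e.2, e.1) | e <- L]) => x y xy.
suff [g [e [eL e12 Exy]]] : E L x y.
  case: Exy => [[-> ->]|[-> ->]].
    by exists g, e; rewrite mem_cat eL.
  exists g, (e.2, e.1); split=> //; last by rewrite adjC.
  by rewrite mem_cat orbC; apply/orP; left; apply/mapP; exists e.
have Exy : conn (E L) x y.
  by apply: conn_trans (all y); apply: conn_sym (all x); exact: Esym.
apply: contrapT => nE.
suff : ~~ H x y y by rewrite half_in.
apply: (Exy (fun z => ~~ H x y z)); last exact: half_out.
move=> a b ha Eab; apply/negP => hb; apply: nE.
have ba : adj b a by rewrite adjC; exact: EadjL Eab.
have [<- <-] := half_cross treeP xy ba hb ha; exact: Eab.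
Qed.

(** * Robust graphs *)

(** Invariant graphs with finitely many orbits of edges are given in this way
    by finite data. *)
Definition span_rel K (L : seq (T * T)) x y := exists k p, [/\ K k, p \in L &
  (x, y) = (act k p.1, act k p.2) \/ (x, y) = (act k p.2, act k p.1)].

Definition avoiding (F : seq T) (E : T -> T -> Prop) x y :=
  [/\ E x y, x \notin F & y \notin F].

Definition pairs_in N (p : T * T) := [/\ N p.1, N p.2 & p.1 <> p.2].

(** This is the (n+1)-connectedness of graph theory, without its condition on
    the number of vertices. *)
Definition robust n N (E : T -> T -> Prop) :=
  forall F : seq T, size F <= n -> forall x y, N x -> N y ->
  x \notin F -> y \notin F -> conn (avoiding F E) x y.

Definition invariant_under K N := forall k x, K k -> N x -> N (act k x).

Definition orbits K N (l : seq T) :=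
  forall x, N x -> exists k y, [/\ K k, y \in l, N y & x = act k y].

Lemma span_sym K L x y : span_rel K L x y -> span_rel K L y x.
Proof.
by move=> [k [p [Kk pL [[-> ->]|[-> ->]]]]]; exists k, p; split=> //; [right|left].
Qed.

Lemma span_mono K K' L L' x y : K `<=` K' -> {subset L <= L'} ->
  span_rel K L x y -> span_rel K' L' x y.
Proof.
by move=> KK' LL' [k [p [/KK' Kk /LL' pL E]]]; exists k, p.
Qed.

Lemma span_act K L k x y : is_subgroup K -> K k ->
  span_rel K L x y -> span_rel K L (act k x) (act k y).
Proof.
move=> sK Kk [k' [p [Kk' pL E]]]; exists (k * k')%g, p; split=> //.
  exact: subM.
by rewrite !actM; case: E => -[-> ->]; [left|right].
Qed.

Lemma span_in K N L x y : invariant_under K N ->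
  (forall p, p \in L -> pairs_in N p) -> span_rel K L x y -> pairs_in N (x, y).
Proof.
move=> KN LN [k [p [Kk /LN[N1 N2 p12] [[-> ->]|[-> ->]]]]].
  by split=> /=; [exact: KN|exact: KN|move=> /act_inj].
by split=> /=; [exact: KN|exact: KN|move=> /act_inj /esym].
Qed.

Lemma avoiding_mono F F' (E E' : T -> T -> Prop) x y :
  (forall x y, E x y -> E' x y) -> {subset F <= F'} ->
  avoiding F' E x y -> avoiding F E' x y.
Proof.
move=> EE' FF' [Exy xF yF]; split; first exact: EE'.
  by apply: contra xF; exact: FF'.
by apply: contra yF; exact: FF'.
Qed.

Lemma avoiding_sym F (E : T -> T -> Prop) x y :
  (forall x y, E x y -> E y x) -> avoiding F E x y -> avoiding F E y x.
Proof. by move=> Es [Exy xF yF]; split=> //; exact: Es. Qed.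

(** Choosing representatives of orbits may yield pairs that are degenerate or
    leave N; they can be discarded. *)
Lemma valid_filter N (L : seq (T * T)) : exists L' : seq (T * T),
  (forall p, p \in L' -> pairs_in N p) /\
  (forall p, p \in L -> pairs_in N p -> p \in L').
Proof.
exists [seq p <- L | `[< pairs_in N p >]]; split=> p.
  by rewrite mem_filter => /andP[/asboolP].
by move=> pL Np; rewrite mem_filter pL andbT; apply/asboolP.
Qed.

(** As in a Cayley graph, joining a base vertex to its images under the
    generators and to representatives of the orbits is enough. *)
Lemma robust_fg K N l : is_subgroup K -> finitely_generated K ->
  invariant_under K N -> orbits K N l ->
  exists L, (forall p, p \in L -> pairs_in N p) /\ robust 0 N (span_rel K L).
Proof.
move=> sK [s Ks] KN orb.
have [[x0 Nx0]|N0] := pselect (exists x, N x); last first.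
  by exists [::]; split=> // F _ x y Nx; case: N0; exists x.
have [L [LN LP]] := valid_filter N
  ([seq (x0, y) | y <- l] ++ [seq (x0, act g x0) | g <- s]).
exists L; split=> // F; rewrite leqn0 size_eq0 => /eqP-> x y Nx Ny _ _.
set E := avoiding [::] _.
have EL z : (x0, z) \in ([seq (x0, y) | y <- l] ++ [seq (x0, act g x0) | g <- s]) ->
    N z -> conn E x0 z.
  move=> zL Nz; have [<-|xz] := pselect (x0 = z); first exact: conn_refl.
  apply: conn_step; split=> //; exists 1%g, (x0, z); rewrite !act1.
  by split; [exact: sub1|exact: LP|left].
have Esym a b : E a b -> E b a by apply: avoiding_sym => ? ?; exact: span_sym.
have Einv g a b : K g -> E a b -> E (act g a) (act g b).
  by move=> Kg [Eab _ _]; split=> //; exact: span_act.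
have x0K g : K g -> conn E x0 (act g x0).
  move=> Kg; apply: (@conn_orbit _ _ act _ s) => //; try exact: act1.
  - exact: actM.
  - by move=> h a b; rewrite -Ks; exact: Einv.
  - move=> h hs; apply: EL; last by apply: KN => //; rewrite Ks; exact: gen_mem.
    by rewrite mem_cat; apply/orP; right; apply/mapP; exists h.
  - by rewrite -Ks.
have all z : N z -> conn E x0 z.
  move=> /orb[k [z' [Kk z'l Nz' ->]]]; apply: conn_trans (x0K k Kk) _.
  have : conn E x0 z'.
    by apply: EL => //; rewrite mem_cat; apply/orP; left; apply/mapP; exists z'.
  by apply: conn_map => a b; exact: Einv.
by apply: conn_trans (all y Ny); apply: conn_sym (all x Nx).
Qed.

(** Let f be one of n+1 vertices to be removed. Its set of neighbours is
    cofinite for its stabilizer, which is slender, so by induction this set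
    carries an n-robust graph. Adding such a graph for each f allows a walk
    through f to be rerouted among the neighbours of f, avoiding the other n
    vertices as well. *)
Lemma robust_slender n K N l L0 : is_subgroup K -> invariant_under K N ->
  orbits K N l -> (forall p, p \in L0 -> pairs_in N p) ->
  robust 0 N (span_rel K L0) ->
  (forall y, N y -> slender (K `&` fixer y)) ->
  exists L, (forall p, p \in L -> pairs_in N p) /\ robust n N (span_rel K L).
Proof.
elim: n K N l L0 => [|n IH] K N l L0 sK KN orb L0N rob0 slK; first by exists L0.
have [L [LN rob]] := IH K N l L0 sK KN orb L0N rob0 slK.
pose Ny y : set T := [set z | span_rel K L y z].
pose Ky y := K `&` fixer y.
have sKy y : is_subgroup (Ky y) by exact: subgroupI (fixer_subgroup y).
have KyNy y : invariant_under (Ky y) (Ny y).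
  by move=> k z [Kk yk] yz; rewrite /Ny /= -{1}yk; exact: span_act.
pose Q y (L' : seq (T * T)) := N y -> exists Ly : seq (T * T),
  [/\ {subset Ly <= L'}, forall p, p \in Ly -> pairs_in (Ny y) p &
      robust n (Ny y) (span_rel (Ky y) Ly)].
have [L' L'P] : exists L', forall y, y \in l -> Q y L'.
  apply: collect.
    move=> y L1 L2 L12 QL /QL[Ly [sub LyN roby]]; exists Ly; split=> // p /sub.
    exact: L12.
  move=> y _; have [Nyy|nN] := pselect (N y); last by exists [::] => /nN.
  pose Qy (p : T * T) (ly : seq T) := forall z k, K k ->
    (y, z) = (act k p.1, act k p.2) \/ (y, z) = (act k p.2, act k p.1) ->
    exists k' z', [/\ Ky y k', z' \in ly, Ny y z' & z = act k' z'].
  (* An edge at y is a translate of a pair in L by an element sending one of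
     its endpoints to y, and any two such elements differ by the stabilizer of
     y. *)
  have [ly lyP] : exists ly, forall p, p \in L -> Qy p ly.
    apply: collect.
      move=> p l1 l2 l12 Qp z k Kk /(Qp z k Kk)[k' [z' [? /l12 ? ? ?]]].
      by exists k', z'.
    move=> p pL.
    have one a b : ((a, b) = p \/ (b, a) = p) -> exists l1 : seq T, forall z k, K k ->
        (y, z) = (act k a, act k b) ->
        exists k' z', [/\ Ky y k', z' \in l1, Ny y z' & z = act k' z'].
      move=> abp; have [[k0 [Kk0 k0a]]|no] := pselect (exists k, K k /\ act k a = y).
        exists [:: act k0 b] => z k Kk [ya ->].
        exists (k * k0^-1)%g, (act k0 b); split.
        - split; first by apply: subM => //; exact: subV.
          by rewrite /fixer /= -{1}k0a -actM mulgVK.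
        - exact: mem_head.
        - exists k0, p; split=> //; rewrite -k0a.
          by case: abp => <-; [left|right].
        - by rewrite -actM mulgVK.
      by exists [::] => z k Kk [ya _]; case: no; exists k.
    have [l1 l1P] := one p.1 p.2 (or_introl (esym (surjective_pairing p))).
    have [l2 l2P] := one p.2 p.1 (or_intror (esym (surjective_pairing p))).
    exists (l1 ++ l2) => z k Kk [/(l1P z k Kk)|/(l2P z k Kk)] [k' [z' [? ? ? ?]]];
      by exists k', z'; split=> //; rewrite mem_cat; apply/orP; [left + right].
  have orby : orbits (Ky y) (Ny y) ly.
    by move=> z [k [p [Kk pL E]]]; exact: lyP pL z k Kk E.
  have sly : slender (Ky y) by exact: slK.
  have [L1 [L1N rob1]] := robust_fg (sKy y) sly.1 (KyNy y) orby.
  have [z Nz|L2 [L2N rob2]] := IH _ _ _ _ (sKy y) (KyNy y) orby L1N rob1.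
    apply: slender_sub sly _ _; last by move=> g [].
    exact: subgroupI (fixer_subgroup z).
  by exists L2 => _; exists L2; split.
have [L2 [L2N L2P]] := valid_filter N (L ++ L').
exists L2; split=> // F sF x y Nx Ny' xF yF.
have LL2 : {subset L <= L2}.
  by move=> p pL; apply: L2P; [rewrite mem_cat pL|exact: LN].
case: F sF xF yF => [|f F] sF xF yF.
  have := rob [::] isT x y Nx Ny' isT isT; apply: conn_mono => a b.
  by apply: avoiding_mono => // a' b'; exact: span_mono.
have EE2 a b : span_rel K L a b -> span_rel K L2 a b by exact: span_mono.
set E := avoiding (f :: F) _.
have Esym a b : E a b -> E b a by apply: avoiding_sym => ? ?; exact: span_sym.
(* Rerouting among the neighbours of f, after translation to the
   representative f0 of its orbit. *)
have link u w : span_rel K L f u -> span_rel K L f w ->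
    u \notin f :: F -> w \notin f :: F -> conn E u w.
  move=> fu fw uF wF.
  have [Nf _ _] := span_in KN LN fu.
  have [k [f0 [Kk f0l Nf0 Ef]]] := orb f Nf.
  have [Ly [LyL' LyN roby]] := L'P f0 f0l Nf0.
  have Kk' := subV sK Kk.
  have inN z : span_rel K L f z -> Ny f0 (act k^-1%g z).
    by move=> /(span_act sK Kk'); rewrite Ef actK.
  have nF z : z \notin f :: F -> act k^-1%g z \notin map (act k^-1%g) F.
    rewrite inE negb_or => /andP[_]; apply: contra.
    by rewrite mem_map //; exact: act_inj.
  have := roby (map (act k^-1%g) F) _ _ _ (inN u fu) (inN w fw) (nF u uF) (nF w wF).
  rewrite size_map => /(_ sF) /(conn_map (f := act k)).
  move=> /(_ E); rewrite !actKV; apply => a b [ab aF bF].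
  have [Na Nb anb] := span_in (KyNy f0) LyN ab.
  have nf z : Ny f0 z -> z \notin map (act k^-1%g) F -> act k z \notin f :: F.
    move=> f0z zF; rewrite inE negb_or; apply/andP; split.
      apply/eqP; rewrite Ef => /act_inj zf0; have [_ _] := span_in KN LN f0z.
      by apply.
    apply: contra zF => zF; apply/mapP; exists (act k z) => //.
    by rewrite actK.
  split; [|exact: nf|exact: nf].
  apply: span_act => //; case: ab => k' [p [[Kk1 _] pLy Ep]]; exists k', p.
  split=> //; apply: L2P; first by rewrite mem_cat LyL' ?orbT.
  have [N1 N2 p12] := LyN p pLy.
  by split=> //; [have [] := span_in KN LN N1|have [] := span_in KN LN N2].
have [xf xF'] : x <> f /\ x \notin F.
  by move: xF; rewrite inE negb_or => /andP[/eqP].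
have [yf yF'] : y <> f /\ y \notin F.
  by move: yF; rewrite inE negb_or => /andP[/eqP].
have xy := rob F sF x y Nx Ny' xF' yF'.
suff : (y = f /\ (exists2 u, span_rel K L f u /\ u \notin f :: F & conn E x u)) \/
    (y <> f /\ conn E x y) by case=> [[]|[]].
apply: (xy (fun z =>
    (z = f /\ (exists2 u, span_rel K L f u /\ u \notin f :: F & conn E x u)) \/
    (z <> f /\ conn E x z))); last by right; split=> //; exact: conn_refl.
move=> a b + [ab aF bF].
have notin z : z <> f -> z \notin F -> z \notin f :: F.
  by move=> zf zF; rewrite inE negb_or zF andbT; apply/eqP.
have [bf|bf] := pselect (b = f).
  case=> [[af [u fu xu]]|[af xa]]; left; split=> //; first by exists u.
  exists a => //; split; last exact: notin.
  by rewrite -bf; exact: span_sym.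
case=> [[af [u [fu uF] xu]]|[af xa]]; right; split=> //.
  apply: conn_trans xu (link _ _ fu _ uF (notin _ bf bF)).
  by rewrite -af.
apply: conn_trans xa (conn_step _); split; [exact: EE2|exact: notin|exact: notin].
Qed.

End Cofinite.

(** * Turns, bridges and short segments *)

Section Segments.
Variables (G : groupType) (T : Gtree G).
Implicit Types (g h k : G) (x y z u v w : T) (I J : seq T) (C : seq T -> Prop).

Local Notation adj := (@adj G T).
Local Notation act := (@act G T).
Local Notation d := (gdist adj).
Local Notation H := (half adj).
Let treeP : is_tree adj := adj_tree T.

Lemma adjxx x : adj x x = false. Proof. by case: treeP => _ ->. Qed.

Definition short_segment I := is_segment I /\ seg_length I <= 4.

Definition covered (Is : seq (seq T)) I := exists g J, J \in Is /\ I = translate g J.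

Lemma covered_translate Is g I : covered Is I -> covered Is (translate g I).
Proof.
move=> [h [J [JIs ->]]]; exists (g * h)%g, J; split=> //.
by rewrite /translate -map_comp; apply: eq_map => x /=; rewrite actM.
Qed.

Lemma covered_mono Is Is' I : {subset Is <= Is'} -> covered Is I -> covered Is' I.
Proof. by move=> sub [g [J [/sub JIs ->]]]; exists g, J. Qed.

Lemma covered_mem Is I : I \in Is -> covered Is I.
Proof.
exists 1%g, I; split=> //; rewrite -[LHS]map_id; apply: eq_map => x.
by rewrite act1.
Qed.

Lemma translateK g I : translate g^-1%g (translate g I) = I.
Proof.
by rewrite /translate -map_comp -[RHS]map_id; apply: eq_map => x /=; rewrite actK.
Qed.

Lemma is_segmentE x p :
  is_segment (x :: p) <-> path adj x p /\ d x (last x p) = size p.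
Proof. exact: (is_geodesicE treeP). Qed.

Lemma short_segment_translate g I : short_segment (translate g I) -> short_segment I.
Proof.
case: I => [[]//|x p] [/is_segmentE[xp dp] sp].
split; last by move: sp; rewrite /seg_length size_map.
apply/is_segmentE; move: xp dp; rewrite last_map size_map gdist_act => xp dp.
split=> //; move: xp; clear; elim: p x => //= y p IH x.
by rewrite act_adj => /andP[-> /IH].
Qed.

Lemma short_segment3 a v b : adj v a -> adj v b -> a <> b ->
  short_segment [:: a; v; b].
Proof.
rewrite (adjC v a) => av vb ab; split=> //; apply/is_segmentE => /=.
split; first by rewrite av vb.
by rewrite (no_backtrack treeP av vb) // (gdist_adj treeP av) // gdistxx.
Qed.

Lemma short_segment4 a x y b : adj x a -> adj x y -> adj y b ->
  a <> y -> x <> b -> short_segment [:: a; x; y; b].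
Proof.
rewrite (adjC x a) => ax xy yb ay xb; split=> //; apply/is_segmentE => /=.
split; first by rewrite ax xy yb.
have D1 := gdist_adj treeP ax.
have D2 : d a y = 2.
  by rewrite (no_backtrack treeP ax xy) // D1 // gdistxx.
by rewrite (no_backtrack treeP xy yb) // D2 // D1.
Qed.

Lemma short_segment5 a x y z b : adj x a -> adj x y -> adj y z -> adj z b ->
  a <> y -> x <> z -> y <> b -> short_segment [:: a; x; y; z; b].
Proof.
move=> ax xy yz zb ay xz yb; split=> //.
have [/is_segmentE /= [/and4P[ax' _ _ _] D3] _] := short_segment4 ax xy yz ay xz.
have [/is_segmentE /= [_ D2] _] := short_segment3 ax xy ay.
apply/is_segmentE => /=; split; first by rewrite ax' xy yz zb.
by rewrite (no_backtrack treeP yz zb) // D3 // D2.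
Qed.

(** The edges of the Whitehead graph at v. *)
Definition turn C v a b :=
  [/\ adj v a, adj v b, a <> b & C [:: a; v; b] \/ C [:: b; v; a]].

Definition branching x y :=
  exists u u', [/\ adj x u, adj x u', u <> u', u <> y & u' <> y].

(** Bridges are required with their endpoints away from arbitrary a and b: in
    the application x and y lie on a line that goes through a and b, and the
    bridge has to leave this line at both ends. The valence 2 vertex in the
    next definition is the reason for segments of length 4. *)
Definition bridged3 C x y := branching x y -> branching y x -> forall a b,
  exists u w, [/\ [/\ adj x u, u <> y & u <> a], [/\ adj y w, w <> x & w <> b] &
                  C [:: u; x; y; w]].

Definition bridged4 C x y := forall z, adj y z -> z <> x ->
  (forall v, adj y v -> v = x \/ v = z) ->
  branching x y -> branching z y -> forall a b,
  exists u w, [/\ [/\ adj x u, u <> y & u <> a], [/\ adj z w, w <> y & w <> b] &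
                  C [:: u; x; y; z; w]].

(** The combinatorial property of the finite family of segments on which the
    theorem rests, for a given edge [x, y]. It is stated for a predicate C
    because C first means to be a translate of one of the segments, and this
    is transported along the action and restricted to short segments. *)
Definition rich C x y := [/\ robust 2 (neighbours adj x) (turn C x),
  adj x y -> bridged3 C x y & adj x y -> bridged4 C x y].

Lemma rich_mono C C' x y : (forall I, short_segment I -> C I -> C' I) ->
  rich C x y -> rich C' x y.
Proof.
move=> CC' [R B3 B4]; split.
- move=> F sF a b xa xb aF bF; have := R F sF a b xa xb aF bF.
  apply: conn_mono => a' b'; apply: avoiding_mono => // p q [xp xq pq E].
  split=> //; case: E => E; [left|right]; apply: CC' E; apply: short_segment3 => //.
  exact: nesym.
- move=> xy bx by_ a b; have [u [w [[xu uy ua] [yw wx wb] E]]] := B3 xy bx by_ a b.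
  exists u, w; split=> //; apply: CC' E; apply: short_segment4 => //; exact: nesym.
- move=> xy z yz zx val2 bx bz a b.
  have [u [w [[xu uy ua] [zw wy wb] E]]] := B4 xy z yz zx val2 bx bz a b.
  exists u, w; split=> //; apply: CC' E; apply: short_segment5 => //; exact: nesym.
Qed.

Lemma rich_act C g x y : (forall h I, C I -> C (translate h I)) ->
  rich C x y -> rich C (act g x) (act g y).
Proof.
move=> Cact [R B3 B4].
have adjV u v : adj u (act g v) -> adj (act g^-1%g u) v.
  by rewrite -{1}(actKV g u) act_adj.
have neqV u v : u <> act g v -> act g^-1%g u <> v.
  by move=> uv E; apply: uv; rewrite -E actKV.
have branchV u v : branching (act g u) (act g v) -> branching u v.
  move=> [a [b [ga gb ab ag bg]]]; exists (act g^-1%g a), (act g^-1%g b).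
  split; try exact: neqV; last by move=> /act_inj.
    by rewrite adjC; apply: adjV; rewrite adjC.
  by rewrite adjC; apply: adjV; rewrite adjC.
split.
- move=> F sF a b xa xb aF bF.
  have nV z : z \notin F -> act g^-1%g z \notin map (act g^-1%g) F.
    by apply: contra; rewrite mem_map //; exact: act_inj.
  have aV z : adj (act g x) z -> adj x (act g^-1%g z).
    by move=> xz; rewrite adjC; apply: adjV; rewrite adjC.
  have := R (map (act g^-1%g) F) _ _ _ (aV _ xa) (aV _ xb) (nV _ aF) (nV _ bF).
  rewrite size_map => /(_ sF) /(conn_map (f := act g)).
  move=> /(_ (avoiding F (turn C (act g x)))); rewrite !actKV; apply.
  move=> u w [[xu xw uw E] uF wF].
  have nF z : z \notin map (act g^-1%g) F -> act g z \notin F.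
    by apply: contra => zF; apply/mapP; exists (act g z); rewrite ?actK.
  split; [|exact: nF|exact: nF]; split; rewrite ?act_adj //; first by move=> /act_inj.
  by case: E => /(Cact g) E; [left|right].
- rewrite act_adj => xy /branchV bx /branchV by_ a b.
  have [u [w [[xu uy ua] [yw wx wb] E]]] := B3 xy bx by_ (act g^-1%g a) (act g^-1%g b).
  exists (act g u), (act g w); rewrite !act_adj.
  have ne p q : p <> act g^-1%g q -> act g p <> q.
    by move=> pq qE; apply: pq; rewrite -qE actK.
  split; last exact: (Cact g _ E).
    by split=> //; [move=> /act_inj|exact: ne].
  by split=> //; [move=> /act_inj|exact: ne].
- rewrite act_adj => xy z; rewrite -{1 2 3 4}(actKV g z) act_adj.
  move=> yz zx val2 /branchV bx /branchV bz a b.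
  have [||u [w [[xu uy ua] [zw wy wb] E]]] :=
    B4 xy _ yz _ _ bx bz (act g^-1%g a) (act g^-1%g b).
  + by move=> E; apply: zx; rewrite E.
  + move=> v yv; have gyv : adj (act g y) (act g v) by rewrite act_adj.
    by have [/act_inj E|/act_inj E] := val2 _ gyv; [left|right].
  exists (act g u), (act g w); rewrite !act_adj.
  have ne p q : p <> act g^-1%g q -> act g p <> q.
    by move=> pq qE; apply: pq; rewrite -qE actK.
  split.
  + by split=> //; [move=> /act_inj|exact: ne].
  + split; [|by move=> /act_inj|exact: ne].
    by rewrite -(actKV g z) act_adj.
  + by have := Cact g _ E; rewrite /= actKV.
Qed.

(** * Connectedness of the sets of directions *)

Definition edge_step C (e f : T * T) :=
  (f = (e.2, e.1) /\ adj e.1 e.2) \/ (f.1 = e.1 /\ turn C e.1 e.2 f.2).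

(** Finitely many turns suffice to join all edges of the tree by walks, since
    G is finitely generated and there are finitely many orbits of edges. Such
    a walk between two edges at v projects to a walk in the set of directions
    at v, because only its turns at v change the direction in which it lies. *)
Lemma turns_connected : finitely_generated [set: G] ->
  exists Is, forall v, robust 0 (neighbours adj v) (turn (covered Is) v).
Proof.
move=> fgG; have [Le LeP] := edge_orbits T fgG; have [s Gs] := fgG.
have [[e0 Ee0]|noedge] := pselect (exists e, adj e.1 e.2); last first.
  by exists [::] => v F _ a b va; case: noedge; exists (v, a).
have stepmono Is Is' e f : {subset Is <= Is'} ->
    edge_step (covered Is) e f -> edge_step (covered Is') e f.
  move=> sub [E|[E [a1 a2 a3 a4]]]; first by left.
  right; split=> //; split=> //.
  by case: a4 => a4; [left|right]; exact: covered_mono a4.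
have reach f : adj f.1 f.2 -> exists Is, conn (edge_step (covered Is)) e0 f.
  case: f => z u /=; apply: (@conn_tree _ _ treeP adj e0.1 z _
    (fun z => forall u, adj z u -> exists Is, conn (edge_step (covered Is)) e0 (z, u))) => //.
    move=> {}z z' IH zz' {}u z'u; have [Is E] := IH z' zz'.
    have E' : conn (edge_step (covered Is)) e0 (z', z).
      by apply: conn_trans E (conn_step _); left.
    have [<-|zu] := pselect (z = u); first by exists Is.
    exists ([:: z; z'; u] :: Is); apply: (@conn_trans _ _ _ (z', z)).
      apply: conn_mono E' => e f; apply: stepmono => J JIs.
      by rewrite inE JIs orbT.
    apply: conn_step; right; split=> //; split=> //=; first by rewrite adjC.
    by left; apply: covered_mem; exact: mem_head.
  move=> {}u eu; have [E|eu'] := pselect (e0.2 = u).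
    by exists [::]; rewrite -E -surjective_pairing; exact: conn_refl.
  exists [:: [:: e0.2; e0.1; u]]; apply: conn_step; right; split=> //; split=> //.
  by left; apply: covered_mem; exact: mem_head.
pose act2 g (e : T * T) := (act g e.1, act g e.2).
have [Is IsP] : exists Is, forall f, f \in Le ++ [seq act2 g e0 | g <- s] ->
    adj f.1 f.2 -> conn (edge_step (covered Is)) e0 f.
  apply: (collect (Q := fun f Is => adj f.1 f.2 ->
                   conn (edge_step (covered Is)) e0 f)).
    move=> f Is Is' sub E /E; apply: conn_mono => a b; exact: stepmono.
  move=> f _; have [/reach[Is E]|nf] := boolP (adj f.1 f.2); first by exists Is.
  by exists [::].
exists Is => v F; rewrite leqn0 size_eq0 => /eqP-> a b; rewrite /neighbours /= => va vb _ _.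
set E := edge_step (covered Is) in IsP.
have Esym e f : E e f -> E f e.
  case: e f => e1 e2 [f1 f2] [[/= [-> ->] e12]|[/= -> [? ? n12 E12]]].
    by left; rewrite /= adjC.
  right; split=> //; split=> //; first exact: nesym.
  by case: E12 => E12; [right|left].
have Einv g e f : E e f -> E (act2 g e) (act2 g f).
  case: e f => e1 e2 [f1 f2] [[/= [-> ->] e12]|[/= -> [? ? n12 E12]]].
    by left; rewrite /= act_adj.
  right; split=> //; split; rewrite /= ?act_adj //; first by move=> /act_inj.
  by case: E12 => /(covered_translate g) E12; [left|right].
have orb g : conn E e0 (act2 g e0).
  apply: (@conn_orbit _ _ act2 _ s) => //.
  - by case=> x y; rewrite /act2 !act1.
  - by move=> h k e; rewrite /act2 /= !actM.
  - by move=> h e f _; exact: Einv.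
  - move=> h hs; apply: IsP; last by rewrite act_adj.
    by rewrite mem_cat; apply/orP; right; apply/mapP; exists h.
  - by rewrite -Gs.
have all x y : adj x y -> conn E e0 (x, y).
  move=> /LeP[g [e [eL e12 <- <-]]]; apply: conn_trans (orb g) _.
  have : conn E e0 e by apply: IsP => //; rewrite mem_cat eL.
  by apply: (conn_map (f := act2 g)) => ? ?; exact: Einv.
have ab : conn E (v, a) (v, b).
  apply: conn_trans (all v b vb); apply: conn_sym (all v a va); exact: Esym.
set R := avoiding [::] _.
(* The edge e projects to the direction u at v. *)
pose towards u (e : T * T) :=
  (e.1 = v \/ H v u e.1) /\ (e.2 = v \/ H v u e.2).
suff : forall u, adj v u -> towards u (v, b) -> conn R a u.
  by apply=> //; split; [left|right; exact: half_in].
pose P e := adj e.1 e.2 /\ forall u, adj v u -> towards u e -> conn R a u.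
suff [] : P (v, b) by [].
apply: (ab P); last first.
  split=> // u vu [_ [/= E1|/= h]].
    by move: va; rewrite E1 adjxx.
  rewrite (half_disj treeP vu va h (half_in treeP va)); exact: conn_refl.
move=> [z c] [z' c'] [/= zc Pe] [[/= [-> ->] _]|[/= -> [_ zc' cc' E12]]].
  by split=> /=; [rewrite adjC|move=> u vu [? ?]; apply: Pe].
split=> //= u vu [/= tz tc'].
have [zv|zv] := pselect (z = v); last first.
  have hz : H v u z by case: tz.
  apply: Pe => //; split; first by right.
  case hc : (H v u c) => /=; [by right|left].
  by have [] := half_cross treeP vu zc hz (negbT hc).
have {}hc' : H v u c'.
  by case: tc' => // c'v; move: zc'; rewrite zv c'v adjxx.
rewrite zv in zc zc' E12 tz.
have uc' : u = c' by exact: half_disj hc' (half_in treeP zc').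
apply: (@conn_trans _ _ _ c).
  apply: Pe => //; rewrite zv; split; first by left.
  by right; exact: half_in.
by apply: conn_step; split=> //; rewrite uc'; split.
Qed.

End Segments.

Section RichSegments.
Variables (G : groupType) (T : Gtree G).
Implicit Types (g h k : G) (x y z u v w : T) (I J : seq T).

Local Notation adj := (@adj G T).
Local Notation act := (@act G T).
Let treeP : is_tree adj := adj_tree T.

Lemma neighbours_invariant v : invariant_under (fixer v) (neighbours adj v).
Proof. by move=> k x kv vx; rewrite /neighbours /= -{1}kv act_adj. Qed.

Lemma neighbour_orbits v : finitely_generated [set: G] ->
  exists l, orbits (fixer v) (neighbours adj v) l.
Proof.
move=> fgG; have [Le LeP] := edge_orbits T fgG.
pose Q (e : T * T) (l : seq T) := forall u g, adj v u -> act g e.1 = v ->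
  act g e.2 = u -> exists k y, [/\ fixer v k, y \in l, adj v y & u = act k y].
have [l lP] : exists l, forall e, e \in Le -> Q e l.
  apply: collect => [e l l' ll' Ql u g vu E1 E2|e _].
    by have [k [y [? /ll' ? ? ?]]] := Ql u g vu E1 E2; exists k, y.
  have [[g0 [E1 vE2]]|no] :=
      pselect (exists g0, act g0 e.1 = v /\ adj v (act g0 e.2)); last first.
    by exists [::] => u g vu E1 E2; case: no; exists g; rewrite E2.
  exists [:: act g0 e.2] => u g vu E1' <-; exists (g * g0^-1)%g, (act g0 e.2).
  rewrite mem_head -actM mulgVK; split=> //.
  by rewrite /fixer /= -{1}E1 -actM mulgVK.
exists l => u vu; have [g [e [eL _ E1 E2]]] := LeP v u vu.
exact: lP eL u g vu E1 E2.
Qed.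

(** If the tree is locally finite, all turns at v may be taken. If it is
    slender, the stabilizer of v need not be finitely generated, but the
    stabilizers of the directions at v are edge stabilizers, hence slender,
    and the connected graph of [turns_connected] can be made robust. *)
Lemma robust_turns v : finitely_generated [set: G] ->
  locally_finite T \/ slender_tree T ->
  exists Is, robust 2 (neighbours adj v) (turn (covered Is) v).
Proof.
move=> fgG [lf|sl].
  have /finite_seqP[s sE] := lf v.
  exists [seq [:: a; v; b] | a <- s, b <- s] => F _ a b va vb aF bF.
  have [->|ab] := pselect (a = b); first exact: conn_refl.
  apply: conn_step; split=> //; split=> //; left; apply: covered_mem.
  by apply: allpairs_f; [move: va|move: vb]; rewrite sE.
have [l lP] := neighbour_orbits v fgG; have [Is0 rob0] := turns_connected T fgG.
have Ninv := @neighbours_invariant v.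
pose Q I (L : seq (T * T)) := forall u w g, adj v u -> adj v w ->
  [:: u; v; w] = translate g I -> span_rel (fixer v) L u w.
have [L0 L0P] : exists L0, forall I, I \in Is0 -> Q I L0.
  apply: collect => [I L L' LL' QL u w g vu vw E|I _].
    by apply: span_mono (QL u w g vu vw E).
  have [[g0 [u0 [w0 [E0 _ _]]]]|no] := pselect (exists g0 u0 w0,
      [/\ [:: u0; v; w0] = translate g0 I, adj v u0 & adj v w0]); last first.
    by exists [::] => u w g vu vw E; case: no; exists g, u, w.
  exists [:: (u0, w0)] => u w g vu vw; rewrite -(translateK g0 I) -E0 => -[Eu Ev Ew].
  exists (g * g0^-1)%g, (u0, w0); rewrite mem_head !actM -Eu -Ew; split=> //.
    by rewrite /fixer /= actM -Ev.
  by left.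
have [L1 [L1N L1P]] := valid_filter (neighbours adj v) L0.
have rob1 : robust 0 (neighbours adj v) (span_rel (fixer v) L1).
  move=> F sF a b va vb aF bF; have := rob0 v F sF a b va vb aF bF.
  apply: conn_mono => {va vb aF bF} {}a {}b; apply: avoiding_mono => // {}a {}b.
  move=> [va vb ab E].
  have : span_rel (fixer v) L0 a b.
    case: E => -[g [I [IIs E]]]; first exact: (L0P I IIs a b g).
    by apply: span_sym; exact: (L0P I IIs b a g).
  move=> [k [p [kv pL Ep]]]; exists k, p; split=> //; apply: L1P => //.
  have kv' := subV (fixer_subgroup v) kv.
  have back q : adj v (act k q) -> adj v q.
    by move=> /(Ninv _ _ kv'); rewrite actK.
  case: Ep va vb ab => -[-> ->] /back va /back vb ab; split=> //.
    by move=> E'; apply: ab; rewrite E'.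
  by move=> E'; apply: ab; rewrite E'.
have [|L [LN rob]] := robust_slender 2 (fixer_subgroup v) Ninv lP L1N rob1.
  by move=> u vu; exact: sl.
exists [seq [:: p.1; v; p.2] | p <- L] => F sF a b va vb aF bF.
have := rob F sF a b va vb aF bF.
apply: conn_mono => {va vb aF bF} {}a {}b; apply: avoiding_mono => // {}a {}b ab.
have [va vb nab] := span_in Ninv LN ab; split=> //.
have cov k p : fixer v k -> p \in L ->
    covered [seq [:: p.1; v; p.2] | p <- L] [:: act k p.1; v; act k p.2].
  move=> kv pL; exists k, [:: p.1; v; p.2]; split; last by rewrite /= kv.
  by apply/mapP; exists p.
by case: ab => k [p [kv pL [[-> ->]|[-> ->]]]]; [left|right]; exact: cov.
Qed.

(** Each property in question is invariant under G and concerns an edge, so it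
    is enough to achieve it for finitely many edges. *)
Lemma rich_segments : finitely_generated [set: G] ->
  locally_finite T \/ slender_tree T ->
  exists Is, (forall I, I \in Is -> short_segment I) /\
    forall x y, adj x y -> rich (covered Is) x y.
Proof.
move=> fgG lfsl; have [Le LeP] := edge_orbits T fgG.
pose Q (e : T * T) Is := rich (covered Is) e.1 e.2.
have [Is IsP] : exists Is, forall e, e \in Le -> Q e Is.
  apply: collect => [e Is Is' sub|[x y] _].
    by apply: rich_mono => I _; exact: covered_mono.
  have [Is1 R] := robust_turns x fgG lfsl.
  have [Is2 B3] : exists Is, bridged3 (covered Is) x y.
    have [[[u [u' [xu xu' uu' uy uy']]] [w [w' [yw yw' ww' wx wx']]]]|no] :=
      pselect (branching x y /\ branching y x); last first.
      by exists [::] => bx by_; case: no.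
    (* Whatever a and b are, one of u and u' differs from a and one of w and
       w' differs from b. *)
    exists [:: [:: u; x; y; w]; [:: u; x; y; w']; [:: u'; x; y; w]; [:: u'; x; y; w']].
    move=> _ _ a b.
    have [ua|ua] := pselect (u = a); have [wb|wb] := pselect (w = b).
    - exists u', w'; split; [split=> //; congruence|split=> //; congruence|].
      by apply: covered_mem; rewrite !inE eqxx !orbT.
    - exists u', w; split; [split=> //; congruence|split=> //; congruence|].
      by apply: covered_mem; rewrite !inE eqxx !orbT.
    - exists u, w'; split; [split=> //; congruence|split=> //; congruence|].
      by apply: covered_mem; rewrite !inE eqxx !orbT.
    - exists u, w; split; [split=> //; congruence|split=> //; congruence|].
      by apply: covered_mem; rewrite !inE eqxx.
  have [Is3 B4] : exists Is, bridged4 (covered Is) x y.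
    have [[z [yz zx val2 [u [u' [xu xu' uu' uy uy']]] [w [w' [zw zw' ww' wy wy']]]]]|no] :=
      pselect (exists z, [/\ adj y z, z <> x, forall v, adj y v -> v = x \/ v = z,
        branching x y & branching z y]); last first.
      by exists [::] => z yz zx val2 bx bz; case: no; exists z.
    exists [:: [:: u; x; y; z; w]; [:: u; x; y; z; w'];
               [:: u'; x; y; z; w]; [:: u'; x; y; z; w']].
    move=> z' yz' z'x _ _ _ a b.
    have -> : z' = z by case: (val2 _ yz').
    have [ua|ua] := pselect (u = a); have [wb|wb] := pselect (w = b).
    - exists u', w'; split; [split=> //; congruence|split=> //; congruence|].
      by apply: covered_mem; rewrite !inE eqxx !orbT.
    - exists u', w; split; [split=> //; congruence|split=> //; congruence|].
      by apply: covered_mem; rewrite !inE eqxx !orbT.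
    - exists u, w'; split; [split=> //; congruence|split=> //; congruence|].
      by apply: covered_mem; rewrite !inE eqxx !orbT.
    - exists u, w; split; [split=> //; congruence|split=> //; congruence|].
      by apply: covered_mem; rewrite !inE eqxx.
  exists (Is1 ++ Is2 ++ Is3).
  suff [] : [/\ robust 2 (neighbours adj x) (turn (covered (Is1 ++ Is2 ++ Is3)) x),
    bridged3 (covered (Is1 ++ Is2 ++ Is3)) x y &
    bridged4 (covered (Is1 ++ Is2 ++ Is3)) x y] by [].
  split.
  - move=> F sF a b va vb aF bF; have := R F sF a b va vb aF bF.
    apply: conn_mono => {va vb aF bF} {}a {}b; apply: avoiding_mono => // {}a {}b.
    move=> [va vb ab E]; split=> //; case: E => E; [left|right];
      by apply: covered_mono E => I; rewrite !mem_cat => ->.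
  - move=> bx by_ a b; have [u [w [Hu Hw E]]] := B3 bx by_ a b; exists u, w.
    split=> //; apply: covered_mono E => I.
    by rewrite !mem_cat => ->; rewrite orbT.
  - move=> z yz zx v2 bx bz a b; have [u [w [Hu Hw E]]] := B4 z yz zx v2 bx bz a b.
    exists u, w; split=> //; apply: covered_mono E => I.
    by rewrite !mem_cat => ->; rewrite !orbT.
exists [seq I <- Is | `[< short_segment I >]]; split=> [I|x y].
  by rewrite mem_filter => /andP[/asboolP].
move=> /LeP[g [e [eL _ <- <-]]].
have : rich (covered Is) (act g e.1) (act g e.2).
  by apply: rich_act; [move=> h I; exact: covered_translate|exact: IsP].
apply: rich_mono => I sI [h [J [JIs E]]]; exists h, J; split=> //.
rewrite mem_filter JIs andbT; apply/asboolP; apply: (@short_segment_translate _ _ h).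
by rewrite -E.
Qed.

End RichSegments.

(** * Equivariant maps and actions on a line *)

Section EdgeMap.
Variables (G : groupType) (S T : Gtree G).

(** As inversions are excluded, sending one edge of each orbit to a point
    fixed by its stabilizer extends to an equivariant map on unoriented edges.
    No such map need exist on vertices, whose stabilizers may fail to be
    elliptic in T. *)
Lemma edge_map : elliptic_wrt S T -> exists p : S -> S -> T,
  (forall x y, p x y = p y x) /\
  (forall g x y, adj x y -> p (act g x) (act g y) = act g (p x y)).
Proof.
move=> ell; have [_ _ [x0 _] _ _] := adj_tree S.
have [_ _ [t1 _] _ _] := adj_tree T.
pose orb (x y : S) : set (S * S) :=
  [set e | exists g, e = (act g x, act g y) \/ e = (act g y, act g x)].
pose rep x y := xget (x0, x0) (orb x y).
pose fp (e : S * S) : T :=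
  xget t1 [set t | forall g, edge_stab e.1 e.2 g -> act g t = t].
pose im x y : set T := [set t | exists g, (let e := rep x y in
  (x, y) = (act g e.1, act g e.2) \/ (x, y) = (act g e.2, act g e.1)) /\
  t = act g (fp (rep x y))].
have orbC x y : orb x y = orb y x.
  by apply/seteqP; split=> e [g [->|->]]; exists g; [right|left|right|left].
have orb_act g x y : orb (act g x) (act g y) = orb x y.
  apply/seteqP; split=> e [h [->|->]].
  - by exists (h * g)%g; left; rewrite !actM.
  - by exists (h * g)%g; right; rewrite !actM.
  - by exists (h * g^-1)%g; left; rewrite -!actM !mulgVK.
  - by exists (h * g^-1)%g; right; rewrite -!actM !mulgVK.
have imC x y : im x y = im y x.
  apply/seteqP; rewrite /im /rep orbC; set e := xget _ _.
  split=> t [g [E tE]]; exists g; split=> //; move: E => /=;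
    by case=> -[Ex Ey]; [right|left]; congr (_, _).
have im_act g x y t : im x y t -> im (act g x) (act g y) (act g t).
  rewrite /im /rep /= orb_act => -[h [E ->]]; exists (g * h)%g.
  split; last by rewrite actM.
  by case: E => -[Ex Ey]; [left|right]; rewrite !actM -Ex -Ey.
have repP x y : orb x y (rep x y).
  by apply: (@xgetPex _ (x0, x0) (orb x y)); exists (x, y), 1%g; left; rewrite !act1.
have imP x y : exists t, im x y t.
  have [g E] := repP x y.
  have gK (z : S) : z = act g^-1%g (act g z) by rewrite actK.
  exists (act g^-1%g (fp (rep x y))), g^-1%g; split=> //.
  by case: E => -> /=; [left|right]; rewrite !actK.
have im_uniq x y t t' : adj x y -> im x y t -> im x y t' -> t = t'.
  move=> xy [g [E ->]] [g' [E' ->]]; move: E E'; set e := rep x y => /= E E'.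
  have e12 : adj e.1 e.2.
    by case: E xy => -[-> ->]; rewrite act_adj // adjC.
  have fixe g1 : edge_stab e.1 e.2 g1 -> act g1 (fp e) = fp e.
    have [t2 t2P] := ell _ _ e12.
    by apply: (@xgetPex _ t1 [set t | forall g, edge_stab e.1 e.2 g -> act g t = t]);
      exists t2.
  have [[E1 E2]|[E1 E2]] : (act g e.1 = act g' e.1 /\ act g e.2 = act g' e.2) \/
      (act g e.1 = act g' e.2 /\ act g e.2 = act g' e.1).
  - case: E E' => -[Ex Ey] [[Ex' Ey']|[Ex' Ey']];
      rewrite -?Ex -?Ey -?Ex' -?Ey'; by [left|right].
  - apply: (@act_inj _ _ g^-1%g); rewrite actK -actM fixe //.
    by split; rewrite actM -?E1 -?E2 actK.
  - case: (act_no_inversion e12 (g := (g^-1 * g')%g)).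
    by split; rewrite actM -?E1 -?E2 actK.
have pP x y : im x y (xget t1 (im x y)) by exact: xgetPex.
exists (fun x y => xget t1 (im x y)); split=> [x y|g x y xy]; first by rewrite imC.
apply: (im_uniq _ _ _ _ (_ : adj (act g x) (act g y)) (pP _ _)); first by rewrite act_adj.
exact/im_act/pP.
Qed.

End EdgeMap.

Section Aux.
Variables (G : groupType) (T : Gtree G).
Implicit Types (g h k : G) (x y z : T) (l m : int -> T).

Local Notation adj := (@adj G T).
Local Notation act := (@act G T).
Local Notation d := (gdist adj).
Local Notation H := (half adj).
Let treeP : is_tree adj := adj_tree T.

(** A line contains exactly two points at a given positive distance from a
    given one. *)
Lemma line_subset l m : is_line adj l -> is_line adj m ->
  (forall i, range m (l i)) -> forall j, range l (m j).
Proof.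
move=> lP mP lm j; have [k0 _ E0] := lm 0%R.
have [k1 _ E1] := lm `|j - k0|%N; have [k2 _ E2] := lm (- `|j - k0|%N%:Z)%R.
have D i i' u v : m u = l i -> m v = l i' -> `|u - v|%N = `|i - i'|%N.
  by move=> E E'; rewrite -(line_dist treeP mP) E E' (line_dist treeP lP).
have D1 := D _ _ _ _ E0 E1; have D2 := D _ _ _ _ E0 E2; have D3 := D _ _ _ _ E1 E2.
have [jk|jk] : j = k1 \/ j = k2 by lia.
  by exists `|j - k0|%N; rewrite // jk E1 -jk.
by exists (- `|j - k0|%N%:Z)%R; rewrite // [in RHS]jk E2.
Qed.

Lemma off_line l i u : is_line adj l -> adj (l i) u -> ~ range l u ->
  forall j, ~~ H (l i) u (l j).
Proof.
move=> lP iu nu j; have ui : adj u (l i) by rewrite adjC.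
by rewrite -(halfC treeP) // -(line_side i j lP ui nu) half_in.
Qed.

Lemma line_subtree l : is_line adj l -> is_subtree adj (range l).
Proof.
move=> lP; apply: (step_subtree treeP); first by exists (l 0%R), 0%R.
move=> x y x' [i _ <-] [j _ <-] ix' hj; apply: contrapT => nx'.
by move: hj; rewrite (negPf (off_line lP ix' nx' j)).
Qed.

(** The fixed vertices of a normal subset form an invariant subtree. *)
Lemma fixed_all (N : set G) x : (forall g h, N h -> N (g^-1 * h * g)%g) ->
  (forall g, N g -> act g x = x) -> forall g y, N g -> act g y = y.
Proof.
move=> normN Nx g y Ng.
pose A := [set z | forall g, N g -> act g z = z].
suff Ay : A y by exact: Ay.
apply: (@invariant_all _ _ A) => [|h z Az k Nk].
  apply: (step_subtree treeP); first by exists x.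
  move=> u v u' Au Av uu' hv k Nk; apply: (half_disj treeP (v := u) (z := v)) => //.
    by rewrite -{1}(Au k Nk) act_adj.
  by rewrite -{1}(Au k Nk) -{1}(Av k Nk) half_act.
have := Az _ (normN h k Nk); rewrite !actM => E.
by apply: (@act_inj _ _ h^-1%g); rewrite E actK.
Qed.

End Aux.

(** An action on a line factors through a dihedral group. If an element h that
    translates the line is elliptic in T, then the kernel of the action and h
    have fixed points in T; both are normalized by G, so they act trivially on
    T, and orbits in T are finite. But orbits in a non-trivial tree are
    unbounded. *)
Lemma line_case (G : groupType) (S T : Gtree G) (h : G) (l : int -> S) (n : int)
    (t0 : T) :
  is_line (@adj G S) l -> n <> 0%R -> (forall i, act h (l i) = l (i + n)%R) ->
  (forall x, range l x) -> act h t0 = t0 -> ~ trivial_tree T ->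
  elliptic_wrt S T -> False.
Proof.
move=> lP n0 hl all ht0 ntT ell.
have dl := line_dist (adj_tree S) lP.
pose N : set G := [set g | forall x : S, act g x = x].
have stabN g : act g (l 0%R) = l 0%R -> act g (l 1%R) = l 1%R -> N g.
  move=> g0 g1 x; have [j _ <-] := all x; have [j' _ E] := all (act g (l j)).
  have := gdist_act g (l 0%R) (l j); have := gdist_act g (l 1%R) (l j).
  rewrite g0 g1 -E !dl => D1 D0; congr l; lia.
have [t1 t1P] := ell _ _ (line_adj (adj_tree S) lP 0%R).
have Ntriv g (t : T) : N g -> act g t = t.
  move=> Ng; apply: (@fixed_all _ _ N t1) => // [g1 k Nk x|g1 Ng1].
    by rewrite !actM Nk actK.
  by apply: t1P; split; exact: Ng1.
have aff g : exists e c : int, (e = 1%R \/ e = (-1)%R) /\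
    forall i, act g (l i) = l (e * i + c)%R.
  have [c0 _ E0] := all (act g (l 0%R)); have [c1 _ E1] := all (act g (l 1%R)).
  exists (c1 - c0)%R, c0.
  have D01 := gdist_act g (l 0%R) (l 1%R); rewrite -E0 -E1 !dl in D01.
  have e1 : (c1 - c0 = 1 \/ c1 - c0 = -1)%R by lia.
  split=> // i; have [j _ E] := all (act g (l i)); rewrite -E; congr l.
  have := gdist_act g (l 0%R) (l i); have := gdist_act g (l 1%R) (l i).
  by rewrite -E -E0 -E1 !dl; case: e1 => e1; rewrite e1 => *; lia.
have htriv (t : T) : act h t = t.
  apply: (@fixed_all _ _ [set g | (forall i, act g (l i) = l (i + n)%R) \/
      (forall i, act g (l i) = l (i - n)%R)] t0); last by left.
    move=> g k kE; have [e [c [e1 gl]]] := aff g.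
    have inv i : act g^-1%g (l (e * i + c)%R) = l i by rewrite -gl actK.
    have conj (m : int) : (forall i, act k (l i) = l (i + m)%R) ->
        forall i, act (g^-1 * k * g)%g (l i) = l (i + e * m)%R.
      move=> km i; rewrite !actM gl km -[RHS]inv; congr (act _ (l _)).
      by case: e1 => ->; lia.
    case: kE => /conj; case: e1 => -> E; [left|right|right|left] => i; rewrite E;
      by congr l; lia.
  have fixh k : (forall i, act k (l i) = act h (l i)) -> act k t0 = t0.
    move=> kh; have : act (h^-1 * k)%g t0 = t0.
      by apply: Ntriv => x; have [i _ <-] := all x; rewrite actM kh actK.
    by rewrite actM => E; rewrite -{2}ht0 -{2}E actKV.
  move=> k [kE|kE]; first by apply: fixh => i; rewrite kE hl.
  rewrite -[k]invgK; apply/act_fixV/fixh => i; apply: (@act_inj _ _ k).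
  by rewrite actKV hl kE; congr l; lia.
have [a [b ab]] : exists a b : T, adj a b.
  by exists t0; exact: nontrivial_adj.
(* Modulo the kernel an element is determined by its values at l 0 and
   l 1, and multiplying it by a power of h brings the first of them to one
   of the l i with 0 <= i < |n|; neither changes the image of t0. *)
pose Q (e : S * S) R := forall g, act g (l 0%R) = e.1 -> act g (l 1%R) = e.2 ->
  gdist (@adj G T) a (act g t0) <= R.
have [R RP] : exists R, forall e, e \in [seq (l (Posz i), l (Posz i + s)%R) |
    i <- iota 0 `|n|, s <- [:: 1%R; (-1)%R]] -> Q e R.
  apply: collect_bound => [e m m' mm' Qe g g0 g1|e _].
    exact: leq_trans (Qe g g0 g1) mm'.
  have [[g0 [E0 E1]]|no] := pselect (exists g0, act g0 (l 0%R) = e.1 /\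
      act g0 (l 1%R) = e.2); last by exists 0 => g E0 E1; case: no; exists g.
  exists (gdist (@adj G T) a (act g0 t0)) => g E0' E1'.
  suff -> : act g t0 = act g0 t0 by [].
  apply: (@act_inj _ _ g0^-1%g); rewrite actK -actM Ntriv //.
  by apply: stabN; rewrite actM ?E0' ?E1' -?E0 -?E1 actK.
have bound g : gdist (@adj G T) a (act g t0) <= R.
  have [e [c [e1 gl]]] := aff g.
  have nn : (n != 0)%R by apply/eqP.
  have c_ge := modz_ge0 c nn; have c_lt := ltz_mod c nn.
  have [k [kt kl]] : exists k, (forall t : T, act k t = t) /\
      forall i, act k (l i) = l (i - (c %/ n)%Z * n)%R.
    have pw (m : nat) : (forall t : T, act (h ^+ m)%g t = t).
      by move=> t; exact: act_fixX.
    have [cn|cn] : (0 <= (c %/ n)%Z)%R \/ ((c %/ n)%Z <= 0)%R by lia.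
      exists (h ^- `|(c %/ n)%Z|)%g; split=> [t|i]; first exact/act_fixV/pw.
      apply: (@act_inj _ _ (h ^+ `|(c %/ n)%Z|)%g).
      by rewrite actKV (axis_pow _ _ hl); congr l; nia.
    exists (h ^+ `|(c %/ n)%Z|)%g; split=> // i.
    by rewrite (axis_pow _ _ hl); congr l; nia.
  rewrite -(kt (act g t0)) -actM; apply: (RP (l (c %% n)%Z, l ((c %% n)%Z + e)%R)).
  - apply/allpairsP; exists (`|(c %% n)%Z|%N, e); split=> /=.
    + by rewrite mem_iota; lia.
    + by case: e1 => ->; rewrite !inE.
    + by rewrite gez0_abs.
  - by rewrite actM gl kl; congr l; have := divz_eq c n; lia.
  - by rewrite actM gl kl; congr l; have := divz_eq c n; lia.
have [g [_]] := orbit_deep ntT t0 R.+1 ab.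
by rewrite ltnNge bound.
Qed.

(** * Axes that are elliptic in the second tree *)

Section Splitting.
Variables (G : groupType) (S T : Gtree G).
Implicit Types (g k : G) (u v w x y z : S).

Local Notation actS := (@act G S).
Local Notation actT := (@act G T).
Local Notation adjS := (@adj G S).
Local Notation adjT := (@adj G T).
Local Notation dS := (gdist adjS).
Local Notation HS := (half adjS).
Local Notation HT := (half adjT).
Let treeS : is_tree adjS := adj_tree S.
Let treeT : is_tree adjT := adj_tree T.

Variables (a b : T) (p : S -> S -> T).
Hypothesis ab : adjT a b.
Hypothesis pC : forall x y, p x y = p y x.
Hypothesis p_act : forall g x y, adjS x y -> p (actS g x) (actS g y) = actT g (p x y).

Variables (h : G) (l : int -> S) (n : int) (t0 : T).
Hypotheses (lP : is_line adjS l) (n0 : n <> 0%R).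
Hypothesis hl : forall i, actS h (l i) = l (i + n)%R.
Hypothesis ht0 : actT h t0 = t0.

Variable Is : seq (seq S).
Hypothesis richP : forall x y, adjS x y -> rich (covered Is) x y.
Hypothesis IsP : forall I, I \in Is -> exists g, line_contains l (translate g I).

Local Notation K := (edge_stab a b).

Definition side x y := HT a b (p x y).

(** The conjugate of h by g has the axis g l in S and fixes g t0 in T. The
    proof compares these fixed points through the corresponding axes. *)
Definition fix_side g := HT a b (actT g t0).

Definition touches g v w := exists i, HS v w (actS g (l i)).

(** These axes have to be set apart: their ends say nothing about the fixed
    point, as they may be the ends of a line preserved by the stabilizer of
    [a, b]. *)
Definition power_fixes g := exists m : nat, 0 < m /\ K (g * h ^+ m * g^-1)%g.

Lemma sideC x y : side x y = side y x.
Proof. by rewrite /side pC. Qed.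

Lemma covered_axis I : covered Is I ->
  exists g, forall z, z \in I -> exists i, z = actS g (l i).
Proof.
move=> [g [J [/IsP[k kJ] ->]]]; exists (g * k^-1)%g => _ /mapP[z zJ ->].
have [i _ E] := kJ (actS k z) (map_f _ zJ); exists i.
by rewrite E actM actK.
Qed.

Lemma axis_line g : is_line adjS (actS g \o l).
Proof. exact: line_act. Qed.

Lemma conj_power_translate g m i :
  actS (g * h ^+ m * g^-1)%g ((actS g \o l) i) = (actS g \o l) (i + m%:Z * n)%R.
Proof. by rewrite /= -actM mulgVK actM (axis_pow _ _ hl). Qed.

(** Otherwise infinitely many translates of [a, b] would separate the fixed
    point from the image of one edge of the axis; two of these translates
    would coincide, which puts a power of the conjugate in the stabilizer of
    [a, b]. *)
Lemma axis_end (k : G) (m : int) g i :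
  (forall i, actS k (l i) = l (i + m)%R) -> actT k t0 = t0 ->
  (exists q : nat, side (actS g (l (i + q%:Z * m)%R))
                        (actS g (l (i + q%:Z * m + 1)%R)) = fix_side g) \/
  exists q : nat, 0 < q /\ K (g * k ^+ q * g^-1)%g.
Proof.
move=> kl kt0; apply: contrapT => /not_orP[nside nK].
pose e (q : nat) := (actT (g * k ^+ q)^-1%g a, actT (g * k ^+ q)^-1%g b).
have [L LP] := separating_edges treeT (p (l i) (l (i + 1)%R)) t0.
have eL q : e q \in L.
  apply: LP; rewrite ?act_adj // -!half_actV.
  rewrite !actM -[actT (k ^+ q)%g t0](_ : t0 = _); last by rewrite act_fixX.
  rewrite -!p_act ?(line_adj treeS lP) //; last by rewrite act_adj (line_adj treeS lP).
  apply/eqP => E; apply: nside; exists q; rewrite /fix_side -E /side.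
  rewrite !(axis_pow _ _ kl); congr (HT a b (p _ (actS g (l _)))); lia.
have [q [q' [qq' [Ea Eb]]]] := pigeonhole eL.
apply: nK; exists (q' - q); split; first by rewrite subn_gt0.
have E : (g * k ^+ (q' - q) * g^-1 = (g * k ^+ q') * (g * k ^+ q)^-1)%g.
  by rewrite expgnFr ?(ltnW qq') // invgM !mulgA.
by split; rewrite E actM ?Ea ?Eb actKV.
Qed.

Lemma axis_ends g i : ~ power_fixes g ->
  (exists j : int, (i <= j)%R /\ side (actS g (l j)) (actS g (l (j + 1)%R)) = fix_side g) /\
  (exists j : int, (j <= i)%R /\ side (actS g (l j)) (actS g (l (j + 1)%R)) = fix_side g).
Proof.
move=> nbad.
have nbadV q : 0 < q -> ~ K (g * h^-1 ^+ q * g^-1)%g.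
  move=> q0 /(subV (edge_stab_subgroup a b)); rewrite expVgn !invgM !invgK => Kq.
  by apply: nbad; exists q; rewrite -mulgA.
have [[q E]|] := axis_end g i hl ht0; last by move=> [q [q1 q2]]; case: nbad; exists q.
have [[q' E']|] := axis_end g i (axisV hl) (act_fixV ht0); last first.
  by move=> [q' [q1 q2]]; case: (nbadV q').
have [n_gt0|n_lt0] : (0 < n)%R \/ (n < 0)%R by lia.
  by split; [exists (i + q%:Z * n)%R|exists (i + q'%:Z * - n)%R]; split=> //; nia.
by split; [exists (i + q'%:Z * - n)%R|exists (i + q%:Z * n)%R]; split=> //; nia.
Qed.

(** The set of edges of S sent beyond [a, b] has its coboundary at these
    vertices. *)
Definition separated z :=
  exists u w, [/\ adjS z u, adjS z w & side z u <> side z w].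

(** The side is constant along a walk that meets no separated vertex. *)
Lemma side_const v w : adjS v w -> (forall z, HS v w z -> ~ separated z) ->
  forall z u, HS v w z -> adjS z u -> side z u = side v w.
Proof.
move=> vw nsep z; move En: (dS w z) => m; elim: m z En => [|m IH] z En u hz zu.
  have E := gdist_eq0 treeS En; rewrite -E in zu *.
  apply: contrapT => ne; apply: (nsep w); first exact: half_in.
  by exists u, v; split; rewrite ?(sideC w v) // adjC.
have [z' zz' Ez'] := gdist_step treeS En.
have hz' : HS v w z'.
  apply: contrapT => /negP hz'; have [zw _] := half_cross treeS vw zz' hz hz'.
  by move: En; rewrite zw gdistxx.
rewrite -(IH z' Ez' z hz') ?(adjC z') // [RHS]sideC.
by apply: contrapT => ne; apply: (nsep z hz); exists u, z'.
Qed.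

(** The axis has an end in the half-tree, where the side is constant. *)
Lemma fix_side_const v w g : adjS v w -> (forall z, HS v w z -> ~ separated z) ->
  touches g v w -> ~ power_fixes g -> fix_side g = side v w.
Proof.
move=> vw nsep [i hi] nbad; have [[j [ij Ej]] [j' [ij' Ej']]] := axis_ends i nbad.
have ladj (q : int) : adjS (actS g (l q)) (actS g (l (q + 1)%R)).
  by rewrite act_adj (line_adj treeS lP).
have [up|dn] := line_ray treeS (axis_line g) vw hi.
  by rewrite -Ej; apply: side_const => //; exact: up.
by rewrite -Ej'; apply: side_const => //; exact: dn.
Qed.

(** Modulo the stabilizer of [a, b] there are only finitely many separated
    vertices, so they are at bounded distance from an orbit. Indeed the set of
    directions at such a vertex is connected, so it contains a turn whose two
    edges have their images on different sides. There are finitely many orbits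
    of turns, and for each of them finitely many translates of [a, b] separate
    the images of its two edges. *)
Lemma separated_bounded x0 : exists R, forall z, separated z ->
  exists k, K k /\ dS z (actS k x0) <= R.
Proof.
pose Q (I : seq S) R := forall g u v w, I = [:: u; v; w] -> adjS v u -> adjS v w ->
  side (actS g v) (actS g u) <> side (actS g v) (actS g w) ->
  exists k, K k /\ dS (actS g v) (actS k x0) <= R.
have [R RP] : exists R, forall I, I \in Is -> Q I R.
  apply: collect_bound => [I m m' mm' QI g u v w E vu vw ne|I _].
    by have [k [Kk le]] := QI g u v w E vu vw ne; exists k; split=> //; exact: leq_trans mm'.
  have [[u [v [w [EI vu vw]]]]|no] :=
    pselect (exists u v w, [/\ I = [:: u; v; w], adjS v u & adjS v w]); last first.
    by exists 0 => g u v w E vu vw; case: no; exists u, v, w.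
  have [L LP] := separating_edges treeT (p v u) (p v w).
  pose Q' (e : T * T) R := forall g, e = (actT g^-1%g a, actT g^-1%g b) ->
    exists k, K k /\ dS (actS g v) (actS k x0) <= R.
  have [R RP] : exists R, forall e, e \in L -> Q' e R.
    apply: collect_bound => [e m m' mm' Qe g E|e _].
      by have [k [Kk le]] := Qe g E; exists k; split=> //; exact: leq_trans mm'.
    have [[g0 E0]|no] := pselect (exists g, e = (actT g^-1%g a, actT g^-1%g b));
      last by exists 0 => g E; case: no; exists g.
    exists (dS (actS g0 v) x0) => g; rewrite E0 => -[Ea Eb].
    exists (g * g0^-1)%g; split.
      by split; rewrite actM ?Ea ?Eb actKV.
    by rewrite -(gdist_act (g * g0^-1)%g (actS g0 v)) -actM mulgVK.
  exists R => g u' v' w'; rewrite EI => -[<- <- <-] _ _ ne.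
  apply: (RP (actT g^-1%g a, actT g^-1%g b)) => //; apply: LP; first by rewrite act_adj.
  by rewrite -!half_actV -!p_act //; apply/eqP.
exists R => z [u [w [zu zw ne]]].
have [rob _ _] := richP zu.
have conn_uw := rob [::] isT u w zu zw isT isT.
apply: contrapT => far; apply: ne.
suff /(_ erefl) : side z u = side z u -> side z w = side z u by [].
apply: (conn_uw (fun q => side z u = side z u -> side z q = side z u)) => //.
move=> q q' IH [[zq zq' qq' E] _ _] _; rewrite -(IH erefl).
apply: contrapT => ne; apply: far.
case: E => -[g [J [JIs E]]]; case: J E JIs => [|j1 [|j2 [|j3 []]]] //= [E1 E2 E3] JIs.
  have v1 : adjS j2 j1 by rewrite -(act_adj g) -E1 -E2.
  have v3 : adjS j2 j3 by rewrite -(act_adj g) -E3 -E2.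
  have ne13 : side (actS g j2) (actS g j1) <> side (actS g j2) (actS g j3).
    by rewrite -E1 -E2 -E3; exact: nesym.
  by have := RP _ JIs g j1 j2 j3 erefl v1 v3 ne13; rewrite -E2.
have v1 : adjS j2 j1 by rewrite -(act_adj g) -E1 -E2.
have v3 : adjS j2 j3 by rewrite -(act_adj g) -E3 -E2.
have ne13 : side (actS g j2) (actS g j1) <> side (actS g j2) (actS g j3).
  by rewrite -E1 -E2 -E3.
by have := RP _ JIs g j1 j2 j3 erefl v1 v3 ne13; rewrite -E2.
Qed.

(** * Axes touching a half-tree *)

Definition pure v w := forall g g',
  touches g v w -> touches g' v w -> fix_side g = fix_side g'.

Lemma touches_in g v w i : adjS v w -> w = actS g (l i) -> touches g v w.
Proof. by move=> vw E; exists i; rewrite -E half_in. Qed.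

(** A turn in the family lies on a translate of l, and this translate touches
    both of the half-trees that it joins. *)
Lemma spread v (F : seq S) : size F <= 2 ->
  (forall u, adjS v u -> u \notin F -> pure v u) ->
  forall u u', adjS v u -> adjS v u' -> u \notin F -> u' \notin F ->
  forall g g', touches g v u -> touches g' v u' -> fix_side g = fix_side g'.
Proof.
move=> sF pureF u u' vu vu' uF u'F g g' tg tg'; have [rob _ _] := richP vu.
have uu' := rob F sF u u' vu vu' uF u'F.
suff E : forall g1, touches g1 v u' -> fix_side g1 = fix_side g by rewrite E.
apply: (uu' (fun q => forall g1, touches g1 v q -> fix_side g1 = fix_side g)); last first.
  by move=> g1 t1; exact: pureF t1 tg.
move=> q q' IH [[vq vq' qq' E] qF q'F] g1 t1.
have [g2 [t2 t2']] : exists g2, touches g2 v q /\ touches g2 v q'.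
  case: E => /covered_axis[g2 g2P]; exists g2.
    have [i Ei] := g2P q (mem_head _ _).
    have [j Ej] : exists j, q' = actS g2 (l j) by apply: g2P; rewrite !inE eqxx !orbT.
    by split; [exact: touches_in Ei|exact: touches_in Ej].
  have [i Ei] := g2P q' (mem_head _ _).
  have [j Ej] : exists j, q = actS g2 (l j) by apply: g2P; rewrite !inE eqxx !orbT.
  by split; [exact: touches_in Ej|exact: touches_in Ei].
by rewrite -(IH _ t2); exact: pureF t1 t2'.
Qed.

Lemma touches_next g v w : adjS v w -> touches g v w ->
  exists u, [/\ adjS w u, u <> v & touches g w u].
Proof.
move=> vw [i hi]; have gl := axis_line g.
have [E|zw] := pselect (actS g (l i) = w).
  have [j [ij jv]] : exists j, adjS (l i) (l j) /\ actS g (l j) <> v.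
    have i1 := line_adj treeS lP i; have i2 := line_adj treeS lP (i - 1)%R.
    rewrite subrK adjC in i2.
    have [Ev|nv] := pselect (actS g (l (i + 1)%R) = v); last by exists (i + 1)%R.
    exists (i - 1)%R; split=> // Ev'.
    by have := line_inj treeS gl (etrans Ev (esym Ev')); lia.
  have wj : adjS w (actS g (l j)) by rewrite -E act_adj.
  by exists (actS g (l j)); split=> //; exists j; exact: half_in.
have [u wu hu] := half_exists treeS zw; exists u; split=> //; last by exists i.
by move=> uv; move: hu; rewrite uv (halfC treeS) // hi.
Qed.

(** The core X stands for a fixed vertex or an invariant line of the
    stabilizer of [a, b]. A half-tree disjoint from X is touched only by axes
    whose ends detect the side of the fixed point. Far from X it contains no
    separated vertex, so it is pure; the general case follows by induction on
    the distance to X, because the set of directions at a vertex stays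
    connected when the direction of X is removed. *)
Section Core.
Variables (X : set S) (x0 : S).
Hypothesis Xx0 : X x0.
Hypothesis XK : forall k x, K k -> X x -> X (actS k x).
Hypothesis Xbad : forall g i, power_fixes g -> X (actS g (l i)).

Lemma pure_off_core v w : adjS v w -> (forall x, X x -> ~~ HS v w x) -> pure v w.
Proof.
have [R RP] := separated_bounded x0.
suff aux m : forall v w, adjS v w -> (forall x, X x -> ~~ HS v w x) ->
    (forall x, X x -> R < dS w x + m) -> pure v w.
  by move=> vw vwX; apply: (aux R.+1) => // x _; lia.
elim: m => {v w} [|m IH] v w vw vwX far g g' tg tg'.
  have nsep z : HS v w z -> ~ separated z.
    move=> hz /RP[k [Kk le]]; have Xk := XK Kk Xx0.
    have := half_dist treeS vw hz (vwX _ Xk); have := far _ Xk.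
    have := half_dist treeS vw (half_in treeS vw) (vwX _ Xk).
    rewrite (gdist_sym treeS w v) (gdist_adj treeS vw).
    have : dS z v <> 0.
      move/(gdist_eq0 treeS) => E; move: hz.
      by rewrite E (negPf (half_out treeS _ _)).
    lia.
  have nbad g1 : touches g1 v w -> ~ power_fixes g1.
    by move=> [i hi] /(Xbad i) /vwX; rewrite hi.
  by rewrite !(fix_side_const vw nsep) //; exact: nbad.
have [u [wu uv tu]] := touches_next vw tg.
have [u' [wu' u'v tu']] := touches_next vw tg'.
apply: (spread (v := w) (F := [:: v]) _ _ wu wu') => //; rewrite ?inE; try exact/eqP.
move=> q wq; rewrite inE => /eqP qv.
have wqX x : X x -> ~~ HS w q x.
  by move=> Xx; apply: contra (vwX x Xx); exact: half_sub.
apply: IH => // x Xx; have := far x Xx.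
have := half_dist treeS wq (half_in treeS wq) (wqX x Xx).
by rewrite (gdist_sym treeS q w) (gdist_adj treeS wq); lia.
Qed.

End Core.

Lemma both_sides : exists g g', fix_side g /\ ~~ fix_side g'.
Proof.
have [g hg] := orbit_half t0 ab; have ba : adjT b a by rewrite adjC.
have [g' hg'] := orbit_half t0 ba; exists g, g'; split=> //.
by rewrite /fix_side -(halfC treeT).
Qed.

(** All half-trees at a fixed vertex x are pure, and the set of directions at
    x is connected, so all the points g t0 lie on one side of [a, b]; this
    contradicts minimality of T. *)
Lemma core_vertex x : ~ (forall k, K k -> actS k x = x).
Proof.
move=> Kx.
have XK k z : K k -> [set x] z -> [set x] (actS k z).
  by move=> Kk ->; exact: Kx.
have Xbad g i : power_fixes g -> [set x] (actS g (l i)).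
  move=> [m [m0 /Kx fix_x]]; exfalso; move: fix_x.
  by apply: (translate_nofix (axis_line g) (conj_power_translate g m)); nia.
have touch g : exists2 u, adjS x u & touches g x u.
  have [i gix] : exists i, actS g (l i) <> x.
    have [E|] := pselect (actS g (l 0%R) = x); last by exists 0%R.
    exists 1%R => E'.
    by have := line_inj treeS (axis_line g) (etrans E (esym E')).
  by have [u xu hu] := half_exists treeS gix; exists u => //; exists i.
have [g [g' [tg]]] := both_sides.
have [u xu tu] := touch g; have [u' xu' tu'] := touch g'.
suff <- : fix_side g = fix_side g' by rewrite tg.
apply: (spread (v := x) (F := [::]) _ _ xu xu') => // q xq _.
apply: (pure_off_core (erefl x : [set x] x) XK Xbad xq) => _ ->.
exact: half_out.
Qed.

Section LineCore.
Variable m : int -> S.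
Hypothesis mP : is_line adjS m.
Hypothesis mK : forall k i, K k -> range m (actS k (m i)).

Lemma power_fixes_in_line g i : power_fixes g -> range m (actS g (l i)).
Proof.
move=> [q [q0 Kk]].
apply: (invariant_line mP (axis_line g) (conj_power_translate g q)) => [|j|j].
- by nia.
- exact: mK.
- by apply: mK; exact: subV (edge_stab_subgroup a b) Kk.
Qed.

Definition off_at i u := adjS (m i) u /\ ~ range m u.

Lemma pure_off_line i u : off_at i u -> pure (m i) u.
Proof.
move=> [iu nu].
have XK k x : K k -> range m x -> range m (actS k x).
  by move=> Kk [j _ <-]; exact: mK.
have Xbad g j : power_fixes g -> range m (actS g (l j)) by exact: power_fixes_in_line.
apply: (pure_off_core (x0 := m 0%R) _ XK Xbad iu) => [|_ [j _ <-]]; first by exists 0%R.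
exact: off_line.
Qed.

Definition touches_at i g := exists2 u, off_at i u & touches g (m i) u.

(** The set of directions at a vertex of the line stays connected when the two
    directions of the line are removed. *)
Lemma same_vertex i g g' : touches_at i g -> touches_at i g' -> fix_side g = fix_side g'.
Proof.
move=> [u [iu nu] tu] [u' [iu' nu'] tu'].
have notin w : ~ range m w -> w \notin [:: m (i - 1)%R; m (i + 1)%R].
  by move=> nw; rewrite !inE; apply/norP; split; apply/eqP => E; apply: nw; rewrite E;
     [exists (i - 1)%R|exists (i + 1)%R].
apply: (spread (v := m i) (F := [:: m (i - 1)%R; m (i + 1)%R]) _ _ iu iu') => //;
  try exact: notin.
move=> w iw wF; apply: pure_off_line; split=> // -[j _ E]; move: wF.
by rewrite -E in iw *; have [->|->] := line_adjE treeS mP iw; rewrite !inE eqxx ?orbT.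
Qed.

Lemma off_branching i j u : off_at i u -> (j = i + 1 \/ j = i - 1)%R ->
  branching (m i) (m j).
Proof.
move=> [iu nu] ji; pose j' := if (j == i + 1)%R then (i - 1)%R else (i + 1)%R.
have ij' : adjS (m i) (m j').
  rewrite /j'; case: eqP => _; last exact: line_adj.
  by rewrite adjC -{2}(subrK 1%R i); exact: line_adj.
exists u, (m j'); split=> //.
- by move=> E; apply: nu; rewrite E; exists j'.
- by move=> E; apply: nu; rewrite E; exists j.
- by move=> /(line_inj treeS mP); rewrite /j'; case: eqP; lia.
Qed.

Lemma off_nonline i u j j' : adjS (m i) u -> u <> m j -> u <> m j' ->
  (j = i - 1 /\ j' = i + 1 \/ j = i + 1 /\ j' = i - 1)%R -> off_at i u.
Proof.
move=> iu uj uj' jj'; split=> // -[q _ E]; rewrite -E in iu uj uj'.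
by have [Eq|Eq] := line_adjE treeS mP iu; case: jj' => -[Ej Ej'];
   [apply: uj'|apply: uj|apply: uj|apply: uj']; congr m; lia.
Qed.

Lemma join_adjacent i u w : off_at i u -> off_at (i + 1)%R w ->
  exists g, touches_at i g /\ touches_at (i + 1)%R g.
Proof.
move=> ou ow; have xy := line_adj treeS mP i.
have [_ B3 _] := richP xy.
have bx : branching (m i) (m (i + 1)%R) by apply: (off_branching ou); left.
have by_ : branching (m (i + 1)%R) (m i) by apply: (off_branching ow); right; lia.
have [u' [w' [[xu uy ua] [yw wx wb] E]]] :=
  B3 xy bx by_ (m (i - 1)%R) (m (i + 1 + 1)%R).
have [g gP] := covered_axis E; exists g.
have [q Eq] := gP u' (mem_head _ _).
have [q' Eq'] : exists j, w' = actS g (l j) by apply: gP; rewrite !inE eqxx !orbT.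
split.
  exists u'; last exact: touches_in Eq.
  by apply: off_nonline xu uy ua _; right; split; lia.
exists w'; last exact: touches_in Eq'.
by apply: off_nonline yw wx wb _; left; split; lia.
Qed.

Lemma join_skip i u w : off_at i u -> off_at (i + 2)%R w ->
  (forall v, ~ off_at (i + 1)%R v) ->
  exists g, touches_at i g /\ touches_at (i + 2)%R g.
Proof.
move=> ou ow val2; have xy := line_adj treeS mP i.
have [_ _ B4] := richP xy.
have Ei2 : (i + 1 + 1 = i + 2)%R by lia.
have yz : adjS (m (i + 1)%R) (m (i + 2)%R) by rewrite -Ei2; exact: line_adj.
have zx : m (i + 2)%R <> m i by move=> /(line_inj treeS mP); lia.
have v2 v : adjS (m (i + 1)%R) v -> v = m i \/ v = m (i + 2)%R.
  move=> yv; apply: contrapT => /not_orP[v1 v2]; apply: (val2 v).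
  by apply: off_nonline yv v1 v2 _; left; split; lia.
have bx : branching (m i) (m (i + 1)%R) by apply: (off_branching ou); left.
have bz : branching (m (i + 2)%R) (m (i + 1)%R).
  by apply: (off_branching ow); right; lia.
have [u' [w' [[xu uy ua] [zw wy wb] E]]] :=
  B4 xy _ yz zx v2 bx bz (m (i - 1)%R) (m (i + 2 + 1)%R).
have [g gP] := covered_axis E; exists g.
have [q Eq] := gP u' (mem_head _ _).
have [q' Eq'] : exists j, w' = actS g (l j) by apply: gP; rewrite !inE eqxx !orbT.
split.
  exists u'; last exact: touches_in Eq.
  by apply: off_nonline xu uy ua _; right; split; lia.
exists w'; last exact: touches_in Eq'.
by apply: off_nonline zw wy wb _; left; split; lia.
Qed.

(** A vertex where nothing branches off the line has valence 2. It is the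
    unique fixed point of some element, as it is not redundant, and this
    element must exchange its neighbours. *)
Lemma valence2_reflection i : (forall u, ~ off_at i u) ->
  exists g, [/\ actS g (m i) = m i, actS g (m (i - 1)%R) = m (i + 1)%R &
                actS g (m (i + 1)%R) = m (i - 1)%R].
Proof.
move=> noff.
have i1 := line_adj treeS mP i.
have i2 : adjS (m i) (m (i - 1)%R).
  by rewrite adjC -{2}(subrK 1%R i); exact: line_adj.
have nb v : adjS (m i) v -> v = m (i - 1)%R \/ v = m (i + 1)%R.
  move=> iv; apply: contrapT => /not_orP[v1 v2]; apply: (noff v).
  by apply: off_nonline iv v1 v2 _; left.
have [g gP] : exists g, forall y, actS g y = y <-> y = m i.
  apply: act_no_redundant; exists (m (i - 1)%R), (m (i + 1)%R); split.
    by move=> /(line_inj treeS mP); lia.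
  by apply/seteqP; split=> v /=; [exact: nb|case=> ->].
have gi : actS g (m i) = m i by apply/gP.
have ne j : j <> i -> actS g (m j) <> m j.
  by move=> ji /gP /(line_inj treeS mP).
exists g; split=> //.
  have [E|//] := nb (actS g (m (i - 1)%R)) ltac:(by rewrite -{1}gi act_adj).
  by case: (ne (i - 1)%R) => //; lia.
have [//|E] := nb (actS g (m (i + 1)%R)) ltac:(by rewrite -{1}gi act_adj).
by case: (ne (i + 1)%R) => //; lia.
Qed.

Lemma valence2_act g j j' : actS g (m j) = m j' ->
  (forall u, ~ off_at j u) -> forall u, ~ off_at j' u.
Proof.
move=> gj nj u [j'u nu].
have nb v : adjS (m j') v ->
    actS g^-1%g v = m (j - 1)%R \/ actS g^-1%g v = m (j + 1)%R.
  move=> j'v; have jv : adjS (m j) (actS g^-1%g v) by rewrite -(act_adj g) actKV gj.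
  apply: contrapT => /not_orP[v1 v2]; apply: (nj (actS g^-1%g v)).
  by apply: off_nonline jv v1 v2 _; left.
have j1 := line_adj treeS mP j'.
have j2 : adjS (m j') (m (j' - 1)%R).
  by rewrite adjC -{2}(subrK 1%R j'); exact: line_adj.
have u1 : actS g^-1%g u <> actS g^-1%g (m (j' + 1)%R).
  by move=> /act_inj E; apply: nu; rewrite E; exists (j' + 1)%R.
have u2 : actS g^-1%g u <> actS g^-1%g (m (j' - 1)%R).
  by move=> /act_inj E; apply: nu; rewrite E; exists (j' - 1)%R.
have n12 : actS g^-1%g (m (j' + 1)%R) <> actS g^-1%g (m (j' - 1)%R).
  by move=> /act_inj /(line_inj treeS mP); lia.
by case: (nb _ j'u) (nb _ j1) (nb _ j2) => Eu [E1|E1] [E2|E2]; congruence.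
Qed.

(** The reflections about two adjacent vertices of valence 2 generate an
    infinite dihedral group, whose translates of these vertices make up the
    whole line; the line is then the whole tree. *)
Lemma no_adjacent_valence2 z i : ~ range m z ->
  (forall u, ~ off_at i u) -> (forall u, ~ off_at (i + 1)%R u) -> False.
Proof.
move=> nz ni ni1.
pose P j := (forall u, ~ off_at j u) /\ (forall u, ~ off_at (j + 1)%R u).
have up j : P j -> P (j + 1)%R.
  move=> [nj nj1]; split=> //; have [g [_ g1 _]] := valence2_reflection nj1.
  by apply: (valence2_act (g := g) _ nj); rewrite -g1 addrK.
have dn j : P j -> P (j - 1)%R.
  move=> [nj nj1]; split; last by rewrite subrK.
  have [g [_ _ g2]] := valence2_reflection nj.
  by apply: (valence2_act (g := g) _ nj1); rewrite -g2.
have [j [u [ju nu _ _]]] := line_off treeS mP nz.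
suff [nj _] : P j by exact: (nj u).
have ups (k : nat) : P (i + k%:Z)%R.
  elim: k => [|k IH]; first by rewrite addr0.
  by rewrite (_ : (i + k.+1%:Z)%R = (i + k%:Z + 1)%R); [exact: up|lia].
have dns (k : nat) : P (i - k%:Z)%R.
  elim: k => [|k IH]; first by rewrite subr0.
  by rewrite (_ : (i - k.+1%:Z)%R = (i - k%:Z - 1)%R); [exact: dn|lia].
have [ij|ij] : (i <= j)%R \/ (j <= i)%R by lia.
  by have := ups `|j - i|%N; rewrite (_ : (i + `|j - i|%N%:Z)%R = j) //; lia.
by have := dns `|j - i|%N; rewrite (_ : (i - `|j - i|%N%:Z)%R = j) //; lia.
Qed.

(** Two successive vertices of the line where something branches off are at
    distance 1 or 2, and a bridge in the family joins them by an axis that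
    leaves the line at both. *)
Lemma same_side z : ~ range m z -> forall g g' i j,
  touches_at i g -> touches_at j g' -> fix_side g = fix_side g'.
Proof.
move=> nz; have branch2 i : (forall u, ~ off_at (i + 1)%R u) -> forall u, off_at i u ->
    exists w, off_at (i + 2)%R w.
  move=> n1 u _; apply: contrapT => n2; apply: (no_adjacent_valence2 nz n1) => w ow.
  by apply: n2; exists w; rewrite (_ : (i + 2 = i + 1 + 1)%R) //; lia.
have aux (k : nat) : forall i g g', touches_at i g -> touches_at (i + k%:Z)%R g' ->
    fix_side g = fix_side g'.
  elim/ltn_ind: k => k IH i g g' tg.
  case: k IH => [|k] IH; first by rewrite addr0; exact: same_vertex.
  move=> tg'; have [u ou _] := tg.
  have [[w ow]|n1] := pselect (exists w, off_at (i + 1)%R w).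
    have [g1 [t1 t2]] := join_adjacent ou ow; rewrite (same_vertex tg t1).
    apply: (IH k (ltnSn k) _ _ _ t2).
    by rewrite (_ : (i + 1 + k%:Z)%R = (i + k.+1%:Z)%R) //; lia.
  have {}n1 w : ~ off_at (i + 1)%R w by move=> ow; apply: n1; exists w.
  case: k IH tg' => [|k] IH tg'; first by have [w /n1] := tg'.
  have [w ow] := branch2 i n1 u ou.
  have [g1 [t1 t2]] := join_skip ou ow n1; rewrite (same_vertex tg t1).
  apply: (IH k (ltnW (ltnSn k.+1)) _ _ _ t2).
  by rewrite (_ : (i + 2 + k%:Z)%R = (i + k.+2%:Z)%R) //; lia.
move=> g g' i j tg tg'; have [ij|ji] : (i <= j)%R \/ (j <= i)%R by lia.
  apply: (aux `|j - i|%N _ _ _ tg).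
  by rewrite (_ : (i + `|j - i|%N%:Z)%R = j) //; lia.
apply/esym; apply: (aux `|j - i|%N _ _ _ tg').
by rewrite (_ : (j + `|j - i|%N%:Z)%R = i) //; lia.
Qed.

(** The axes that leave the core line m all have their fixed points on the
    same side of [a, b], so every point g t0 on the other side comes from an
    axis equal to m. Any two points of an orbit can be moved together to that
    side, by moving one of them deep enough; hence every element of G
    preserves m, which is then the whole tree by minimality. *)
Lemma core_line z : ~ trivial_tree T -> ~ range m z -> False.
Proof.
move=> ntT nz.
have [u [v [uv inm]]] : exists u v : T, adjT u v /\
    forall g, HT u v (actT g t0) -> forall i, range m (actS g (l i)).
  have [g1 [g2 [t1 t2]]] := both_sides.
  have [[g [i off]]|none] := pselect (exists g i, ~ range m (actS g (l i))); last first.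
    by exists a, b; split=> // g _ i; apply: contrapT => off; apply: none; exists g, i.
  have at_ g' i' : ~ range m (actS g' (l i')) -> exists j, touches_at j g'.
    move=> off'; have [j [w [jw nw hw _]]] := line_off treeS mP off'.
    by exists j, w => //; exists i'.
  have [j tj] := at_ g i off.
  have same g' : fix_side g' <> fix_side g -> forall i', range m (actS g' (l i')).
    move=> ne i'; apply: contrapT => /at_[j' tj']; apply: ne.
    exact: (same_side nz tj' tj).
  case tg : (fix_side g) same => same.
    exists b, a; split; first by rewrite adjC.
    by move=> g' hg'; apply: same; rewrite /fix_side -[HT a b _]negbK -(halfC treeT) // hg'.
  by exists a, b; split=> // g' hg'; apply: same; rewrite /fix_side hg'.
have [g1 h1] := orbit_half t0 uv.
have sub k : HT u v (actT k t0) -> (forall i, range m (actS k (l i))) /\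
    (forall j, range (actS k \o l) (m j)).
  move=> hk; have lm := inm k hk; split=> //.
  exact: (line_subset (axis_line k) mP lm).
have pres k j : range m (actS k (m j)).
  (* Move s and its image under k deep into the half-tree: w g1 and w k g1
     then send l to the core line, as g1 does, so w and w k preserve that
     line, and so does k. *)
  pose s := actT g1 t0.
  have [w [hw far]] := orbit_deep ntT s (gdist adjT s (actT k s)).+1 uv.
  have hwk : HT u v (actT (w * k)%g s).
    apply: contrapT => /negP hn; have := half_dist treeT uv hw hn.
    by rewrite actM gdist_act; move: far; rewrite (gdist_sym treeT u); lia.
  have hw1 : HT u v (actT (w * g1)%g t0) by rewrite actM.
  have hwk1 : HT u v (actT (w * k * g1)%g t0) by rewrite actM.
  have [j1 _ E1] := (sub _ h1).2 j.
  have [j2 _ E2] := (sub _ hwk1).1 j1.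
  have [j3 _ E3] := (sub _ hw1).2 j2.
  have [j4 _ E4] := (sub _ h1).1 j3.
  exists j4 => //; rewrite E4; apply: (@act_inj _ _ w).
  by rewrite -actM -[LHS]/((actS (w * g1)%g \o l) j3) E3 E2 -E1 /= -!actM.
have inv x : range m x.
  apply: (@invariant_all _ _ (range m)); first exact: line_subtree.
  by move=> k _ [j _ <-].
exact: nz (inv z).
Qed.

End LineCore.
End Splitting.

Theorem theorem3p1 (G : groupType) (S : Gtree G)
    (G_fg : finitely_generated [set: G])
    (S_lf_or_slender : locally_finite S \/ slender_tree S) :
  exists Is : seq (seq S),
    (forall I, I \in Is -> is_segment I /\ (seg_length I <= 4)%N) /\
    forall (h : G) (l : int -> S),
      hyperbolic S h -> is_axis h l ->
      (forall I, I \in Is ->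
         exists g : G, line_contains l (translate g I)) ->
      forall T : Gtree G,
        ~ trivial_tree T -> slender_tree T -> elliptic_wrt S T ->
        hyperbolic T h.
Proof.
have [Is [shortIs richIs]] := rich_segments G_fg S_lf_or_slender.
exists Is; split=> // h l _ [lP [n [n0 hl]]] IsP T ntT slT ell [t0 ht0].
have [a [b ab]] : exists a b : T, adj a b by exists t0; exact: nontrivial_adj.
have [p [pC p_act]] := edge_map ell.
have [[x Kx]|[m [mP mK]]] :=
    slender_core S (edge_stab_subgroup a b) (slT a b ab).
  exact: (core_vertex ab pC p_act lP n0 hl ht0 richIs IsP Kx).
have [all|/existsNP[z nz]] := pselect (forall z, range m z); last first.
  exact: (core_line ab pC p_act lP n0 hl ht0 richIs IsP mP mK ntT nz).
apply: (line_case lP n0 hl _ ht0 ntT ell) => x; have [j _ <-] := all x.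
exact: (line_subset lP mP).
Qed.
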